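(* Let $q$ be a prime power, $n\ge1$, let $\mathbf{g}=(g_1,\dots,g_n)$ be positive integers and $\boldsymbol{\rho}=(\rho_1,\dots,\rho_n)$ with $\rho_i>0$, $\sum_i\rho_i=1$. Information packets are partitioned into disjoint generations $G_1,\dots,G_n$ with $|G_i|=g_i$. At each transmission (over a perfect channel) the source independently chooses generation $G_i$ with probability $\rho_i$ and sends a linear combination of its packets with coefficient vector drawn uniformly from $GF(q)^{g_i}$, independently of everything else. Let $M_i$ be the number of coded packets of $G_i$ received at the moment $G_i$ first has $g_i$ linearly independent coefficient vectors (so the $M_i$ are independent and $M_i$ is distributed as the number of i.i.d.\ uniform vectors in $GF(q)^{g_i}$ needed to span $GF(q)^{g_i}$), and let $W(\boldsymbol{\rho},\mathbf{g})$ be the total number of coded packets transmitted until all generations are decodable. Then \[ E[W(\boldsymbol{\rho},\mathbf{g})]=\int_0^\infty\Bigl(1-\prod_{i=1}^n\bigl(1-e^{-\rho_ix}E_{M_i}[S_{M_i}(\rho_ix)]\bigr)\Bigr)dx \] \[ <\int_0^\infty\Bigl(1-\prod_{i=1}^n\Bigl(1-e^{-\rho_ix}\bigl(S_{g_i}(\rho_ix)+\alpha_{q,g_i}q^{g_i}e^{\rho_ix/q}-\alpha_{q,g_i}q^{g_i}S_{g_i}(\rho_ix/q)\bigr)\Bigr)\Bigr)dx, \] and \[ E[W^2(\boldsymbol{\rho},\mathbf{g})]=2\int_0^\infty x\Bigl(1-\sum_{i=1}^n\rho_i\frac{1-E_{M_i}[S_{M_i-1}(\rho_ix)]e^{-\rho_ix}}{1-E_{M_i}[S_{M_i}(\rho_ix)]e^{-\rho_ix}}\prod_{j=1}^n\bigl(1-E_{M_j}[S_{M_j}(\rho_jx)]e^{-\rho_jx}\bigr)\Bigr)dx+\int_0^\infty\Bigl(1-\prod_{i=1}^n\bigl(1-e^{-\rho_ix}E_{M_i}[S_{M_i}(\rho_ix)]\bigr)\Bigr)dx,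 \] where $\alpha_{q,g_i}=-\sum_{k=0}^{g_i-1}\ln(1-q^{k-g_i})$ for $i=1,\dots,n$.
   Context: For an integer $m\ge1$, $S_m(x)=\sum_{j=0}^{m-1}\frac{x^j}{j!}$; $S_m(x)=0$ for $m\le 0$; $S_\infty(x)=e^x$. $E_{M_i}[\cdot]$ denotes expectation over the random variable $M_i$. *)

(* Defs.v *)
From HB Require Import structures.
From mathcomp Require Import all_boot all_order all_algebra.
From mathcomp Require Import all_classical all_reals all_analysis.
Unset Printing Implicit Defensive.
Import Order.TTheory GRing.Theory Num.Theory numFieldNormedType.Exports.
Local Open Scope ring_scope.

Definition Spart {R : realType} (m : nat) (x : R) : R :=
  \sum_(j < m) x ^+ j / (j`!)%:R.

Definition probw {R : realType} (T : finType) (w : nat) (p : T -> R)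
  (A : pred {ffun 'I_w -> T}) : R :=
  \sum_(s : {ffun 'I_w -> T} | A s) \prod_(k < w) p (s k).

Definition spans_upto (F : finFieldType) (d w : nat)
  (s : {ffun 'I_w -> 'rV[F]_d}) (m : nat) : bool :=
  row_full (\sum_(k < w | (k < m)%N) genmx (s k))%MS.

Definition pM {R : realType} (F : finFieldType) (d m : nat) : R :=
  probw _ m (fun _ : 'rV[F]_d => ((#|F| ^ d)%:R)^-1)
    (fun s : {ffun 'I_m -> 'rV[F]_d} =>
       spans_upto F d m s m && ~~ spans_upto F d m s m.-1).

(* E_M[ f(M) ] as a (convergent, nonneg-term) real series *)
Definition E_M {R : realType} (F : finFieldType) (d : nat) (f : nat -> R) : R :=
  limn (series (fun m => pM F d m * f m)).

Definition pkt (F : finFieldType) (n : nat) (g : 'I_n -> nat) : finType :=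
  {j : 'I_n & 'rV[F]_(g j)}.

Definition pkt_weight {R : realType} (F : finFieldType) (n : nat) (g : 'I_n -> nat)
  (rho : 'I_n -> R) (x : pkt F n g) : R :=
  rho (tag x) / (#|F| ^ g (tag x))%:R.

Definition decodable_upto (F : finFieldType) (n : nat) (g : 'I_n -> nat) (w : nat)
  (s : {ffun 'I_w -> pkt F n g}) (m : nat) (i : 'I_n) : bool :=
  row_full (\sum_(k < w | (k < m)%N)
               untag (i:=i) (0 : 'M[F]_(g i)) (fun v : 'rV[F]_(g i) => genmx v) (s k))%MS.

Definition all_decodable_upto (F : finFieldType) (n : nat) (g : 'I_n -> nat) (w : nat)
  (s : {ffun 'I_w -> pkt F n g}) (m : nat) : bool :=
  [forall i, decodable_upto F n g w s m i].

Definition pW {R : realType} (F : finFieldType) (n : nat) (g : 'I_n -> nat)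
  (rho : 'I_n -> R) (w : nat) : R :=
  probw _ w (fun x : pkt F n g => pkt_weight F n g rho x)
    (fun s : {ffun 'I_w -> pkt F n g} =>
       all_decodable_upto F n g w s w && ~~ all_decodable_upto F n g w s w.-1).

Local Open Scope ereal_scope.
Definition EW {R : realType} (F : finFieldType) (n : nat) (g : 'I_n -> nat)
  (rho : 'I_n -> R) : \bar R :=
  \sum_(0 <= w <oo) ((w%:R * pW F n g rho w)%R)%:E.
Definition EW2 {R : realType} (F : finFieldType) (n : nat) (g : 'I_n -> nat)
  (rho : 'I_n -> R) : \bar R :=
  \sum_(0 <= w <oo) (((w ^ 2)%:R * pW F n g rho w)%R)%:E.
Local Close Scope ereal_scope.

Definition alpha {R : realType} (q g : nat) : R :=
  - \sum_(k < g) ln (1 - ((q%:R : R) ^- (g - k))).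

(* Main.v *)
Require Import Defs.
From HB Require Import structures.
From mathcomp Require Import all_boot all_order all_algebra.
From mathcomp Require Import all_classical all_reals all_analysis.
From mathcomp Require Import finalg mxabelem measurable_realfun ring lra.
Import Order.TTheory GRing.Theory Num.Theory numFieldNormedType.Exports.
Local Open Scope ring_scope.

(** Poissonization. If packets arrive at the times of a unit-rate Poisson
  process, the numbers of packets received from the generations at time [x] are
  independent Poisson variables of parameters [rho i * x]. Hence, with [c t] the
  probability that [t] packets suffice and [D i k] the probability that [k]
  uniform vectors span generation [i],
  [\sum_t c t * x^t / t! = \prod_i \sum_k D i k * (rho i * x)^k / k!],
  and [\int_0^oo e^-x * x^t / t! dx = 1] turns [E W = \sum_t (1 - c t)] into the
  first integral. For the second moment the same argument, applied at the time
  of one extra packet, gives [E W (W - 1) = 2 * \sum_t t * (1 - c t)].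

  For the bound, [D i k = \prod_(j < g i) (1 - q^j / q^k)], so that
  [1 - D i k <= \sum_(j < g i) q^(j - k) < alpha * q^(g i - k)] for [k >= g i].
  For [q = 2] the bounding factors can be negative, so the products are compared
  through absolute values, which requires [alpha <= 1 + D i (g i)]. *)

(** * Spanning probabilities and mixtures over generations *)

(** Probability that a uniform [k] by [c] matrix over a field of [q] elements has rank [c]: its
    columns are exposed one by one, and column [j] must avoid a subspace with [q^j] of the [q^k]
    points. Here [c] is the codimension still to be covered. *)
Definition span_prob {R : fieldType} (q : R) (k c : nat) : R :=
  \prod_(j < c) (1 - q ^+ j / q ^+ k).

Lemma span_prob0 (R : fieldType) (q : R) c : span_prob q 0 c = (c == 0)%:R.
Proof.
case: c => [|c]; first by rewrite /span_prob big_ord0.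
by rewrite /span_prob big_ord_recl !expr0 divr1 subrr mul0r.
Qed.

(* A uniform vector falls into a given subspace of codimension c with
   probability q^-c, and otherwise lowers the codimension by one. *)
Lemma span_probS (R : fieldType) (q : R) k c : q != 0 ->
  span_prob q k.+1 c =
    span_prob q k c / q ^+ c + span_prob q k c.-1 * (1 - (q ^+ c)^-1).
Proof.
move=> q0; case: c => [|c] /=.
  by rewrite /span_prob !big_ord0 expr0 invr1 subrr mulr0 addr0 mulr1.
(* The factor [j = 0] is peeled off; the others are those of [k], because q^(j+1) / q^(k+1) = q^j /
   q^k. *)
have eS : span_prob q k.+1 c.+1 = (1 - (q ^+ k.+1)^-1) * span_prob q k c.
  rewrite /span_prob big_ord_recl expr0 div1r; congr (_ * _).
  apply: eq_bigr => i _; rewrite lift0 !exprS; congr (1 - _).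
  by field; rewrite q0 expf_neq0.
rewrite eS {2}/span_prob big_ord_recr /= -/(span_prob q k c) !exprS.
by field; rewrite q0 !expf_neq0.
Qed.

(** Conditioning on the first of [k.+1] uniform vectors: the [q^r] vectors of [A] keep its rank [r],
    all others raise it by one, and [span_probS] adds up the two cases. *)
Lemma sum_span_prob (R : numFieldType) (F : finFieldType) (d k : nat)
    (A : 'M[F]_d) :
  \sum_(v : 'rV[F]_d)
    ((#|F| ^ d)%:R : R)^-1
      * span_prob (#|F|%:R : R) k (d - \rank (A + genmx v)%MS)
  = span_prob (#|F|%:R) k.+1 (d - \rank A).
Proof.
set q : R := #|F|%:R; set c := (d - \rank A)%N; set r := \rank A.
have q0 : q != 0 by rewrite pnatr_eq0 -lt0n; apply/card_gt0P; exists 0.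
have rk (v : 'rV[F]_d) : \rank (A + genmx v)%MS = if (v <= A)%MS then r else r.+1.
  case: ifPn => vA.
    have gA : (genmx v <= A)%MS by rewrite genmxE.
    by rewrite (addsmx_idPl gA).
  apply/eqP; rewrite eqn_leq; apply/andP; split.
    apply: leq_trans (mxrank_adds_leqif A (genmx v)) _.
    by rewrite -/r -[r.+1]addn1 leq_add2l mxrank_gen rank_leq_row.
  apply: rank_ltmx; rewrite ltmxE addsmxSl /=.
  by apply: contra vA => /(submx_trans (addsmxSr _ _)); rewrite genmxE.
have rd : (r <= d)%N by exact: rank_leq_row.
have cA : #|[pred v : 'rV[F]_d | (v <= A)%MS]| = (#|F| ^ r)%N.
  by rewrite -card_rowg; apply: eq_card => v; rewrite inE mem_rowg.
have cAc : (#|[pred v : 'rV[F]_d | ~~ (v <= A)%MS]|)%:R = q ^+ d - q ^+ r :> R.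
  have := cardC [pred v : 'rV[F]_d | (v <= A)%MS].
  rewrite cA card_mx mul1n => /(congr1 (fun m => m%:R : R)).
  by rewrite natrD !natrX -/q => <-; rewrite addrAC subrr add0r.
rewrite -mulr_sumr (bigID (fun v => (v <= A)%MS)) /=.
under eq_bigr => v vA do rewrite rk vA -/c.
under [X in _ + X]eq_bigr => v vA do rewrite rk (negbTE vA) subnS -/c.
rewrite !sumr_const cA -[X in _ + X]mulr_natr cAc -(mulr_natr _ (#|F| ^ r)) !natrX -/q.
rewrite span_probS //.
have -> : q ^+ d = q ^+ r * q ^+ c by rewrite -exprD subnKC.
by field; rewrite !expf_neq0.
Qed.

(** For a probability vector [rho], this is the expectation of [\prod_i D i (K i)] with multinomial
    counts [K] of [w] trials. Recursion on the first trial avoids multinomial coefficients and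
    matches the reading of one packet. *)
Fixpoint mix {R : pzRingType} {n} (rho : 'I_n -> R) (w : nat)
    (D : 'I_n -> nat -> R) : R :=
  if w is w'.+1 then
    \sum_(j < n) rho j * mix rho w' (fun i k => D i (k + (i == j))%N)
  else \prod_(i < n) D i 0%N.

Lemma eq_mix (R : pzRingType) n (rho : 'I_n -> R) w (D E : 'I_n -> nat -> R) :
  (forall i k, (k <= w)%N -> D i k = E i k) -> mix rho w D = mix rho w E.
Proof.
elim: w D E => [|w IH] D E DE /=; first by apply: eq_bigr => i _; apply: DE.
apply: eq_bigr => j _; congr (_ * _); apply: IH => i k kw; apply: DE.
by rewrite -addn1 leq_add // leq_b1.
Qed.

Lemma ler_mix (R : numDomainType) n (rho : 'I_n -> R) w
    (D E : 'I_n -> nat -> R) : (forall i, 0 <= rho i) ->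
  (forall i k, 0 <= D i k <= E i k) -> 0 <= mix rho w D <= mix rho w E.
Proof.
move=> rho0; elim: w D E => [|w IH] D E DE /=.
  apply/andP; split; last exact: ler_prod.
  by apply: prodr_ge0 => i _; case/andP: (DE i 0%N).
have IHj j := IH (fun i k => D i (k + (i == j))%N)
  (fun i k => E i (k + (i == j))%N) (fun i k => DE i _).
apply/andP; split.
  by apply: sumr_ge0 => j _; rewrite mulr_ge0 //; case/andP: (IHj j).
by apply: ler_sum => j _; rewrite ler_wpM2l //; case/andP: (IHj j).
Qed.

Lemma mix1 (R : pzRingType) n (rho : 'I_n -> R) w :
  \sum_(i < n) rho i = 1 -> mix rho w (fun _ _ => 1) = 1.
Proof.
move=> rho1; elim: w => [|w IH] /=; first by rewrite big1.
by under eq_bigr => j _ do rewrite IH mulr1.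
Qed.

(** Each product inside [mix] has exactly one factor of index [j], so [mix] is linear in that
    argument, and averages over the vector of a packet pass through it. *)
Lemma mix_linear (R : comPzRingType) n (rho : 'I_n -> R) w (j : 'I_n)
    (I : finType) (c : I -> R) (E : I -> nat -> R) (D : 'I_n -> nat -> R) :
  \sum_v c v * mix rho w (fun i => if i == j then E v else D i) =
  mix rho w (fun i => if i == j then fun k => \sum_v c v * E v k else D i).
Proof.
elim: w E D => [|w IH] E D /=.
  rewrite (bigD1 j) //= eqxx mulr_suml; apply: eq_bigr => v _.
  rewrite (bigD1 j) //= eqxx mulrA; congr (_ * _).
  by apply: eq_bigr => i /negbTE->.
under eq_bigr => v _ do rewrite mulr_sumr.
rewrite exchange_big /=; apply: eq_bigr => l _.
under eq_bigr => v _ do rewrite mulrCA.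
rewrite -mulr_sumr; congr (_ * _).
transitivity (\sum_v c v * mix rho w (fun i => if i == j then
    (fun k => E v (k + (j == l))%N) else fun k => D i (k + (i == l))%N)).
  by apply: eq_bigr => v _; congr (_ * _); apply: eq_mix => i k _;
    case: eqP => [->|].
by rewrite IH; apply: eq_mix => i k _; case: eqP => [->|].
Qed.

(** A word of length [w.+1] is a first letter [x] followed by a word [s]; [oapp] with [unlift ord0]
    plays the part of cons. *)
Lemma big_ffun_ordS (R : Type) (idx : R) (op : Monoid.com_law idx)
    (T : finType) w (G : {ffun 'I_w.+1 -> T} -> R) :
  \big[op/idx]_s G s = \big[op/idx]_x \big[op/idx]_(s : {ffun 'I_w -> T})
    G [ffun k => oapp s x (unlift ord0 k)].
Proof.
rewrite pair_big /=.
rewrite (reindex (fun p : T * {ffun 'I_w -> T} =>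
  [ffun k => oapp p.2 p.1 (unlift ord0 k)])) //=.
exists (fun s => (s ord0, [ffun k => s (lift ord0 k)])).
  move=> [x s] _ /=; rewrite ffunE unlift_none; congr pair.
  by apply/ffunP => k; rewrite !ffunE liftK.
move=> s _; apply/ffunP => k; rewrite !ffunE /=.
by case: unliftP => [l ->|->] /=; rewrite ?ffunE.
Qed.

(** The boolean [i == j] serves as an order of derivation, which gives the product rule the shape of
    one step of [mix]. *)
Lemma deriv_prod (R : comNzRingType) n (p : 'I_n -> {poly R}) :
  (\prod_i p i)^`() = \sum_j \prod_i (p i)^`(i == j).
Proof.
elim: n p => [|n IH] p; first by rewrite !big_ord0 derivC.
rewrite big_ord_recl derivM IH big_ord_recl; congr (_ + _).
  by rewrite big_ord_recl eqxx; congr (_ * _).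
rewrite mulr_sumr; apply: eq_bigr => j _; rewrite big_ord_recl /=.
by congr (_ * _); apply: eq_bigr => i _; rewrite (inj_eq lift_inj).
Qed.

(* General Leibniz rule: the products [p i (rho i X)] are exponential
   generating functions of the splitting of [w] steps among the indices. *)
Lemma derivn_prod_mix (R : comNzRingType) n (rho : 'I_n -> R) w
    (p : 'I_n -> {poly R}) :
  (\prod_i (p i \Po (rho i *: 'X)))^`(w).[0] =
  mix rho w (fun i k => (p i)^`(k).[0]).
Proof.
elim: w p => [|w IH] p.
  rewrite derivn0 horner_prod; apply: eq_bigr => i _.
  by rewrite horner_comp hornerZ hornerX mulr0.
rewrite derivSn deriv_prod raddf_sum horner_sum /=; apply: eq_bigr => j _.
transitivity ((rho j *: \prod_i ((p i)^`(i == j) \Po (rho i *: 'X)))^`(w).[0]).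
  congr (_^`(w).[0]).
  rewrite (bigD1 j) //= [in RHS](bigD1 j) //= eqxx derivn1 deriv_comp.
  rewrite derivZ derivX scalerAl; congr (_ * _).
    by rewrite -[rho j *: 1]mul1r -scalerAr mulr1 -scalerAr mulr1.
  by apply: eq_bigr => i /negbTE->.
rewrite derivnZ hornerZ IH; congr (_ * _); apply: eq_mix => i k _.
by rewrite /derivn -iterD.
Qed.

(** * Probabilities of prefix events on finite words *)

Section Probw.
Variables (R : realType) (T : finType) (p : T -> R).

Lemma probwE w (A : pred {ffun 'I_w -> T}) :
  probw T w p A = \sum_s (A s)%:R * \prod_(k < w) p (s k).
Proof.
by rewrite /probw big_mkcond; apply: eq_bigr => s _; case: (A s);
  rewrite ?mul1r ?mul0r.
Qed.

Lemma probw_sub w (A B : pred {ffun 'I_w -> T}) : (forall s, B s -> A s) ->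
  probw T w p (fun s => A s && ~~ B s) = probw T w p A - probw T w p B.
Proof.
move=> BA; rewrite !probwE -sumrB; apply: eq_bigr => s _.
by rewrite -mulrBl; congr (_ * _); case: (B s) (BA s) => [->//|_];
  rewrite ?andbF ?subrr ?andbT ?subr0.
Qed.

Hypothesis p1 : \sum_x p x = 1.

Lemma sum_prod_weight w : \sum_(s : {ffun 'I_w -> T}) \prod_k p (s k) = 1.
Proof. by rewrite -(bigA_distr_bigA (fun=> p)) big1. Qed.

(** [E w m A] is read as the event that the first [m] letters lead from state [A] to a good state.
    Conditioning on the first letter gives the recursion of [h]; the letters after the [m]-th have
    total weight 1. Keeping [m] apart from [w] allows two prefixes of one word to be compared. *)
Lemma probw_markov (S : Type) (act : S -> T -> S) (h : nat -> S -> R)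
    (E : forall w, nat -> S -> pred {ffun 'I_w -> T}) :
  (forall w A s, (E w 0%N A s)%:R = h 0%N A) ->
  (forall w m A x (s : {ffun 'I_w -> T}),
     E w.+1 m.+1 A [ffun k => oapp s x (unlift ord0 k)] = E w m (act A x) s) ->
  (forall m A, h m.+1 A = \sum_x p x * h m (act A x)) ->
  forall w m A, (m <= w)%N -> probw T w p (E w m A) = h m A.
Proof.
move=> E0 ES hS; elim=> [|w IH] [|m] A // mw; rewrite probwE.
- by under eq_bigr => s _ do rewrite E0;
    rewrite -mulr_sumr sum_prod_weight mulr1.
- by under eq_bigr => s _ do rewrite E0;
    rewrite -mulr_sumr sum_prod_weight mulr1.
rewrite hS big_ffun_ordS; apply: eq_bigr => x _.
rewrite -IH // probwE mulr_sumr; apply: eq_bigr => s _.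
rewrite ES mulrCA; congr (_ * _); rewrite big_ord_recl ffunE unlift_none.
by congr (_ * _); apply: eq_bigr => k _; rewrite ffunE liftK.
Qed.

End Probw.

Lemma row_full_span_prob (R : fieldType) (F : fieldType) d (A : 'M[F]_d) (q : R) :
  (row_full A)%:R = span_prob q 0 (d - \rank A).
Proof. by rewrite span_prob0 subn_eq0 col_leq_rank. Qed.

Lemma natr_forall (R : comPzRingType) (I : finType) (P : pred I) :
  [forall i, P i]%:R = \prod_i (P i)%:R :> R.
Proof.
case: (boolP [forall i, P i]) => [/forallP PT|/forallPn[i /negbTE Pi]].
  by rewrite big1 // => i _; rewrite PT.
by rewrite (bigD1 i) //= Pi mul0r.
Qed.

Lemma eqmx_row_full (F : fieldType) m1 m2 d (A : 'M[F]_(m1, d)) (B : 'M[F]_(m2, d)) :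
  (A :=: B)%MS -> row_full A = row_full B.
Proof. by move=> AB; rewrite /row_full AB. Qed.

Lemma big_ordS_lt (R : Type) (idx : R) (op : Monoid.law idx) w m
    (G : 'I_w.+1 -> R) :
  \big[op/idx]_(k < w.+1 | (k < m.+1)%N) G k =
  op (G ord0) (\big[op/idx]_(k < w | (k < m)%N) G (lift ord0 k)).
Proof.
by rewrite big_mkcond big_ord_recl /= [in RHS]big_mkcond.
Qed.

(** * Distribution of the number of vectors needed to span *)

Section OneGeneration.
Variables (R : realType) (F : finFieldType) (d : nat).
Let q : R := #|F|%:R.

Lemma sum_uniform_weight : \sum_(v : 'rV[F]_d) ((#|F| ^ d)%:R : R)^-1 = 1.
Proof.
rewrite sumr_const card_mx mul1n -[LHS]mulr_natr mulVf // pnatr_eq0 expn_eq0 negb_and.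
by rewrite -lt0n; apply/orP; left; apply/card_gt0P; exists 0.
Qed.

(** The state is the row space collected so far, and only its codimension matters; it starts at zero
    with codimension [d]. *)
Lemma probw_spans w m : (m <= w)%N ->
  probw _ w (fun _ : 'rV[F]_d => ((#|F| ^ d)%:R : R)^-1)
    (fun s => spans_upto F d w s m) = span_prob q m d.
Proof.
move=> mw.
have := @probw_markov _ _ _ sum_uniform_weight 'M[F]_d
  (fun A v => (A + genmx v)%MS) (fun m A => span_prob q m (d - \rank A))
  (fun w m A s => row_full (A + \sum_(k < w | (k < m)%N) genmx (s k))%MS)
  _ _ _ w m (0 : 'M[F]_d) mw.
rewrite mxrank0 subn0 => <-.
- rewrite !probwE; apply: eq_bigr => s _; congr ((nat_of_bool _)%:R * _).
  rewrite /spans_upto; apply: eqmx_row_full; apply: eqmx_sym; exact: adds0mx.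
- move=> w' A s; rewrite -row_full_span_prob; congr (nat_of_bool _)%:R.
  rewrite big_pred0 //; apply: eqmx_row_full; exact: addsmx0.
- move=> w' m' A x s; apply: eqmx_row_full.
  rewrite big_ordS_lt ffunE unlift_none /= addsmxA.
  by under eq_bigr => k _ do rewrite ffunE liftK /=.
- by move=> m' A; rewrite -sum_span_prob.
Qed.

(** Since [0.-1 = 0], the event asks for spanning and not spanning at once. *)
Lemma pM0 : pM F d 0 = 0 :> R.
Proof. by rewrite /pM probwE big1 // => s _; rewrite andbN mul0r. Qed.

Lemma pMS m : pM F d m.+1 = span_prob q m.+1 d - span_prob q m d.
Proof.
rewrite /pM probw_sub ?probw_spans //= => s.
rewrite /spans_upto -!sub1mx => /submx_trans; apply.
by apply/sumsmx_subP => k km; apply: (sumsmx_sup k).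
Qed.

End OneGeneration.

(** * Distribution of the number of packets needed by all generations *)

Section Generations.
Variables (R : realType) (F : finFieldType) (n : nat) (g : 'I_n -> nat).
Variable rho : 'I_n -> R.
Hypothesis rho1 : \sum_(i < n) rho i = 1.
Let q : R := #|F|%:R.

Lemma sum_pkt (G : forall i, 'rV[F]_(g i) -> R) :
  \sum_(x : pkt F n g) pkt_weight F n g rho x * G (tag x) (tagged x) =
  \sum_(i < n) rho i * \sum_v ((#|F| ^ g i)%:R)^-1 * G i v.
Proof.
rewrite -(sig_big_dep predT (fun _ => predT)
  (fun i v => rho i / (#|F| ^ g i)%:R * G i v)) /=.
apply: eq_bigr => i _; rewrite mulr_sumr.
by apply: eq_bigr => v _; rewrite mulrA.
Qed.

Lemma sum_pkt_weight : \sum_(x : pkt F n g) pkt_weight F n g rho x = 1.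
Proof.
have := sum_pkt (fun _ _ => 1).
under eq_bigr => x _ do rewrite mulr1.
move=> ->; rewrite -[RHS]rho1; apply: eq_bigr => i _.
under eq_bigr => v _ do rewrite mulr1.
by rewrite sum_uniform_weight mulr1.
Qed.

Definition decoded_by m : R := mix rho m (fun i k => span_prob q k (g i)).

Lemma probw_decodable w m : (m <= w)%N ->
  probw _ w (fun x : pkt F n g => pkt_weight F n g rho x)
    (fun s => all_decodable_upto F n g w s m) = decoded_by m.
Proof.
move=> mw.
pose add (i : 'I_n) (x : pkt F n g) : 'M[F]_(g i) :=
  untag (i:=i) (0 : 'M[F]_(g i)) (fun v : 'rV[F]_(g i) => genmx v) x.
pose h m (A : forall i, 'M[F]_(g i)) :=
  mix rho m (fun i k => span_prob q k (g i - \rank (A i))).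
transitivity (h m (fun=> 0)); last first.
  by apply: eq_mix => i k _; rewrite mxrank0 subn0.
rewrite -(@probw_markov _ _ _ sum_pkt_weight (forall i, 'M[F]_(g i))
  (fun A x i => (A i + add i x)%MS) h
  (fun w m A s => [forall i,
     row_full (A i + \sum_(k < w | (k < m)%N) add i (s k))%MS])
  _ _ _ w m _ mw).
- rewrite !probwE; apply: eq_bigr => s _; congr ((nat_of_bool _)%:R * _).
  apply: eq_forallb => i; apply: eqmx_row_full; apply: eqmx_sym.
  exact: adds0mx.
- move=> w' A s; rewrite /h /= natr_forall; apply: eq_bigr => i _.
  rewrite -row_full_span_prob; congr (nat_of_bool _)%:R.
  by apply: eqmx_row_full; rewrite big_pred0 //; exact: addsmx0.
- move=> w' m' A x s; apply: eq_forallb => i; apply: eqmx_row_full.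
  rewrite big_ordS_lt ffunE unlift_none /= addsmxA.
  by under eq_bigr => k _ do rewrite ffunE liftK /=.
move=> m' A; rewrite /h /=.
rewrite (sum_pkt (fun j v => mix rho m' (fun i k => span_prob q k
  (g i - \rank (A i + add i (Tagged (fun j => 'rV[F]_(g j)) v))%MS)))).
apply: eq_bigr => j _; congr (_ * _).
(* A packet of generation [j] changes only component [j] of the state, so averaging over its vector
   is [mix_linear] followed by [sum_span_prob]. *)
transitivity (\sum_(v : 'rV[F]_(g j)) ((#|F| ^ g j)%:R)^-1 * mix rho m' (fun i =>
  if i == j then fun k => span_prob q k (g j - \rank (A j + genmx v)%MS)
  else fun k => span_prob q k (g i - \rank (A i)))).
  rewrite mix_linear; apply: eq_mix => i k _.
  case: eqP => [->|_]; first by rewrite addn1 sum_span_prob.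
  by rewrite addn0.
apply: eq_bigr => v _; congr (_ * _); apply: eq_mix => i k _.
case: (eqVneq i j) => [-> | ij].
  by rewrite /add (untagE _ _ (erefl (tag (Tagged (fun j => 'rV[F]_(g j)) v)))).
by rewrite /add untag_dflt ?addsmx0 //= eq_sym.
Qed.

Lemma pW0 : pW F n g rho 0 = 0 :> R.
Proof. by rewrite /pW probwE big1 // => s _; rewrite andbN mul0r. Qed.

Lemma pWS m : pW F n g rho m.+1 = decoded_by m.+1 - decoded_by m.
Proof.
rewrite /pW probw_sub ?probw_decodable //= => s /forallP D; apply/forallP => i.
move: (D i); rewrite /decodable_upto -!sub1mx => /submx_trans; apply.
by apply/sumsmx_subP => k km; apply: (sumsmx_sup k).
Qed.
End Generations.

(** * Poissonization of mixtures *)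

Local Open Scope classical_set_scope.

Lemma SpartE (R : realType) m (x : R) : Spart m x = series (exp_coeff x) m.
Proof. by rewrite /series /= big_mkord. Qed.

Lemma continuous_Spart (R : realType) m : continuous (Spart m : R -> R).
Proof.
elim: m => [|m IH] x.
  rewrite (_ : Spart 0 = fun=> 0); first exact: cvg_cst.
  by apply/funext => y; rewrite /Spart big_ord0.
rewrite (_ : Spart m.+1 = fun y => Spart m y + y ^+ m * (m`!%:R)^-1).
  apply: cvgD; first exact: IH.
  by apply: cvgM; [exact: exprn_continuous|exact: cvg_cst].
by apply/funext => y; rewrite /Spart big_ord_recr.
Qed.

Lemma cvg_bigprod (R : realType) (I : finType) (u : I -> nat -> R) (l : I -> R) :
  (forall i, u i @ \oo --> l i) ->
  (fun N => \prod_i u i N) @ \oo --> \prod_i l i.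
Proof.
by move=> ul; apply: cvg_big => [|i _]; [exact: mul_continuous|exact: ul].
Qed.

Section PoissonMixing.
Context {R : realType} {n : nat} (rho : 'I_n -> R) (D : 'I_n -> nat -> R).
Hypotheses (rho0 : forall i, 0 <= rho i) (D0 : forall i k, 0 <= D i k).

(** Cutting every sequence at [N] turns the generating functions into polynomials, to which the
    Leibniz rule applies. *)
Let trunc N i k := if (k < N)%N then D i k else 0.
Let egf N i : {poly R} := \poly_(k < N) (D i k / k`!%:R).
Let prodegf N := \prod_i (egf N i \Po (rho i *: 'X)).

Let egf_deriv N i k : (egf N i)^`(k).[0] = trunc N i k.
Proof.
rewrite horner_coef0 coef_derivn addn0 ffactnn coef_poly /trunc.
by case: ltnP; rewrite ?mul0rn// => _;
  rewrite -[LHS]mulr_natr divfK ?pnatr_eq0 -?lt0n ?fact_gt0.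
Qed.

Let coef_prodegf N w : (prodegf N)`_w = mix rho w (trunc N) / w`!%:R.
Proof.
transitivity ((prodegf N)^`(w).[0] / w`!%:R).
  by rewrite horner_coef0 coef_derivn addn0 ffactnn -[X in X / _]mulr_natr mulfK.
by rewrite derivn_prod_mix; congr (_ / _); apply: eq_mix => i k _;
  apply: egf_deriv.
Qed.

Let prodegfE N x : (prodegf N).[x] =
  \prod_i series (fun k => D i k * exp_coeff (rho i * x) k) N.
Proof.
rewrite horner_prod; apply: eq_bigr => i _.
rewrite horner_comp hornerZ hornerX horner_poly /series /= big_mkord.
by apply: eq_bigr => k _; rewrite /exp_coeff /= mulrA mulrAC.
Qed.

Let trunc_le N i k : 0 <= trunc N i k <= D i k.
Proof. by rewrite /trunc; case: ifP => _; rewrite lexx D0. Qed.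

Let mix_trunc N w : 0 <= mix rho w (trunc N) <= mix rho w D.
Proof. exact: ler_mix. Qed.

(** Truncation leaves the coefficients below [N] intact, as [w] steps give no index more than [w];
    the remaining ones are nonnegative. *)
Let prodegf_ge N x : 0 <= x ->
  series (fun w => mix rho w D * exp_coeff x w) N <= (prodegf N).[x].
Proof.
move=> x0; rewrite (horner_coef_wide _ (leq_maxr N (size (prodegf N)))).
rewrite /series /= -(big_mkord predT (fun i => (prodegf N)`_i * x ^+ i)).
rewrite [leRHS](@big_cat_nat _ _ _ N) ?leq_maxl //=.
rewrite ler_wpDr //.
  apply: sumr_ge0 => w _;
    rewrite mulr_ge0 ?exprn_ge0 // coef_prodegf divr_ge0 //.
  by case/andP: (mix_trunc N w).
rewrite !big_mkord; apply: ler_sum => w _.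
rewrite coef_prodegf mulrAC -mulrA /exp_coeff /= (eq_mix _ _ _ _ (trunc N) D) //.
by move=> i k kw; rewrite /trunc (leq_ltn_trans kw).
Qed.

(** Truncation can only lower a coefficient, and only finitely many are nonzero. *)
Let prodegf_le N x : 0 <= x ->
  (prodegf N).[x] <=
  series (fun w => mix rho w D * exp_coeff x w) (size (prodegf N)).
Proof.
move=> x0; rewrite horner_coef /series /= big_mkord; apply: ler_sum => w _.
rewrite coef_prodegf mulrAC -mulrA /exp_coeff /= ler_wpM2r //.
  by rewrite divr_ge0 ?exprn_ge0.
by case/andP: (mix_trunc N w).
Qed.

(* Poissonization: if step [w] is charged to index [i] with probability
   [rho i], a Poisson number of steps makes the indices independent. *)
Lemma cvg_mix x (l : 'I_n -> R) : 0 <= x ->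
  (forall i, series (fun k => D i k * exp_coeff (rho i * x) k) @ \oo --> l i) ->
  series (fun w => mix rho w D * exp_coeff x w) @ \oo --> \prod_i l i.
Proof.
move=> x0 Dl; set s := series _; set L := \prod_i l i.
have term0 i k : 0 <= D i k * exp_coeff (rho i * x) k.
  by rewrite mulr_ge0 // exp_coeff_ge0 // mulr_ge0.
have pL : (fun N => (prodegf N).[x]) @ \oo --> L.
  by under eq_fun do rewrite prodegfE; exact: cvg_bigprod.
have ple N : (prodegf N).[x] <= L.
  rewrite prodegfE; apply: ler_prod => i _; rewrite /series /= sumr_ge0 //=.
  rewrite -(cvg_lim _ (Dl i)) //; apply: nondecreasing_cvgn_le;
    last by apply/cvg_ex; exists (l i).
  by apply: nondecreasing_series => k _ _; apply: term0.
have snd : nondecreasing_seq s.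
  apply: nondecreasing_series => w _ _; rewrite mulr_ge0 ?exp_coeff_ge0 //.
  by case/andP: (ler_mix _ _ rho w D D rho0 (fun i k => introT andP (conj (D0 i k) (lexx _)))).
have sL N : s N <= L by apply: le_trans (prodegf_ge N _ x0) (ple N).
have sc : cvgn s.
  by apply: nondecreasing_is_cvgn => //; exists L => _ [N _ <-].
suff -> : L = limn s by [].
(* The truncated products tend to [L] and each lies between two partial sums of [s], so the limits
   agree. *)
apply/eqP; rewrite eq_le; apply/andP; split.
  rewrite -(cvg_lim _ pL) //; apply: limr_le; first by apply/cvg_ex; exists L.
  near=> N; apply: le_trans (prodegf_le N _ x0) _; exact: nondecreasing_cvgn_le.
by apply: limr_le => //; near=> N.
Unshelve. all: by end_near. Qed.

End PoissonMixing.

(** * Integrals of Poisson weights *)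

Section GammaIntegral.
Context {R : realType}.

(** The differentiated function is the probability of at most [k] arrivals by time [x] at rate [r];
    the derivatives of its terms telescope and only the last weight survives. *)
Lemma is_derive_poisson_cdf (r : R) k (x : R) :
  is_derive x 1 (fun x : R => expR (- (r * x)) * Spart k.+1 (r * x))
    (- r * (expR (- (r * x)) * exp_coeff (r * x) k)).
Proof.
elim: k => [|k IH].
  rewrite (_ : (fun x => _) = (fun x => expR (- (r * x)))); last first.
    by apply/funext => y; rewrite /Spart big_ord1 expr0 fact0 divr1 mulr1.
  apply: is_derive_eq; rewrite /exp_coeff /= expr0 fact0 divr1 /GRing.scale /=;
    ring.
have e1 : is_derive x 1 (fun x : R => expR (- (r * x))) (- r * expR (- (r * x))).
  by apply: is_derive_eq; rewrite /GRing.scale /=; ring.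
have e2 : is_derive x 1 (fun x : R => (r * x) ^+ k.+1)
    (k.+1%:R * (r * x) ^+ k * r).
  have er : is_derive x 1 (fun x : R => r * x) r.
    by apply: is_derive_eq; rewrite /GRing.scale /=; ring.
  rewrite (_ : (fun x => _) = (fun x : R => r * x) ^+ k.+1); last first.
    by apply/funext => y; rewrite fctE.
  by apply: is_derive_eq; rewrite /GRing.scale.
have e12 := is_deriveD IH (is_deriveZ (k.+1`!%:R^-1) (is_deriveM e1 e2)).
rewrite (_ : (fun x => _) =
   (fun x => expR (- (r * x)) * Spart k.+1 (r * x)) +
   (k.+1`!%:R^-1 *: ((fun x => expR (- (r * x))) * (fun x => (r * x) ^+ k.+1)))); last first.
  apply/funext => y; rewrite /Spart big_ord_recr /= mulrDr fctE; congr (_ + _).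
  by rewrite /GRing.scale /= mulrA mulrC.
apply: (is_derive_eq e12);
  rewrite /exp_coeff /= /GRing.scale /= factS natrM exprS.
have k0 : k`!%:R != 0 :> R by [].
have k1 : k.+1%:R != 0 :> R by [].
move: (expR _) (_ ^+ k) (k`!%:R : R) (k.+1%:R : R) k0 k1 => e y f m f0 m0.
by field; rewrite f0 m0.
Qed.

Lemma cvg_expRN_exp_coeff k :
  (fun y : R => expR (- y) * exp_coeff y k) y @[y --> +oo] --> (0 : R).
Proof.
(* The majorant comes from e^y >= y^(k+1) / (k+1)!. *)
apply: (@squeeze_cvgr _ _ _ _ (fun=> 0) (fun y => k.+1%:R / y)).
- near=> y; have y0 : 0 < y by near: y; exact: nbhs_pinfty_gt.
  apply/andP; split; first by rewrite mulr_ge0 ?expR_ge0 // exp_coeff_ge0 // ltW.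
  have k0 : k`!%:R != 0 :> R by [].
  have k1 : k.+1%:R != 0 :> R by [].
  rewrite expRN mulrC ler_pdivrMr ?expR_gt0 //.
  have ky0 : 0 <= k.+1%:R / y by rewrite divr_ge0 // ltW.
  apply: le_trans (ler_wpM2l ky0 (expR_ge1Dxn k (ltW y0))).
  rewrite [leRHS](_ : _ = k.+1%:R / y + y ^+ k / k`!%:R) ?lerDr //.
  rewrite factS natrM exprS.
  move: (_ ^+ k) (k`!%:R : R) (k.+1%:R : R) k0 k1 {ky0} => e f m f0 m0.
  by field; rewrite f0 m0 gt_eqF.
- exact: cvg_cst.
- rewrite -[X in _ --> X](mulr0 (k.+1%:R : R)); apply: cvgM;
    first exact: cvg_cst.
  apply: ((gtr0_cvgV0 _).2 _); last exact: cvg_id.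
  exact: nbhs_pinfty_gt.
Unshelve. all: by end_near. Qed.

Lemma cvg_poisson_cdf (r : R) k : 0 < r ->
  (fun x : R => expR (- (r * x)) * Spart k (r * x)) x @[x --> +oo] --> (0 : R).
Proof.
move=> r0.
have h : (fun y : R => expR (- y) * Spart k y) y @[y --> +oo] --> (0 : R).
  elim: k => [|k IH].
    rewrite (_ : (fun y => _) = fun=> 0); first exact: cvg_cst.
    by apply/funext => y; rewrite /Spart big_ord0 mulr0.
  rewrite (_ : (fun y => _) =
    (fun y => expR (- y) * Spart k y + expR (- y) * exp_coeff y k)); last first.
    by apply/funext => y; rewrite /Spart big_ord_recr /= mulrDr.
  by rewrite -[X in _ --> X]addr0; apply: cvgD IH _; exact: cvg_expRN_exp_coeff.
by apply: (cvg_comp _ _ _ h); exact: gt0_cvgMry.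
Qed.

Lemma continuous_poisson_weight (r : R) k :
  continuous (fun x : R => expR (- (r * x)) * exp_coeff (r * x) k).
Proof.
have cr : continuous (fun x : R => r * x).
  by move=> x; apply: cvgM; [exact: cvg_cst|exact: cvg_id].
move=> x; apply: cvgM.
  apply: (@continuous_comp _ _ _ (fun x => - (r * x)) expR);
    last exact: continuous_expR.
  by apply: cvgN; exact: cr.
apply: cvgM; last exact: cvg_cst.
by apply: (@continuous_comp _ _ _ (fun x => r * x) (fun y => y ^+ k));
  [exact: cr|exact: exprn_continuous].
Qed.

Lemma integral_poisson_weight (r : R) k : 0 < r ->
  (\int[lebesgue_measure]_(x in `[0%R, +oo[)
    (expR (- (r * x)) * exp_coeff (r * x) k)%:E = (r^-1)%:E)%E.
Proof.
move=> r0.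
(* Up to the factor -1/r this is the Poisson distribution function, which falls from 1 at 0 to 0 at
   infinity. *)
pose G (x : R) : R := - r^-1 * (expR (- (r * x)) * Spart k.+1 (r * x)).
have dG (x : R) : is_derive x 1 G (expR (- (r * x)) * exp_coeff (r * x) k).
  apply: (is_derive_eq (is_deriveZ (- r^-1) (is_derive_poisson_cdf r k x))).
  by rewrite /GRing.scale /= mulrA mulrNN mulVf ?mul1r // gt_eqF.
rewrite (@ge0_continuous_FTC2y _ _ G _ 0).
- by rewrite /G mulr0 oppr0 expR0 SpartE series_exp_coeff0 !mulr1 sub0e EFinN oppeK.
- move=> x x0; rewrite mulr_ge0 ?expR_ge0 // exp_coeff_ge0 // mulr_ge0 //;
    exact: ltW.
- apply: continuous_subspaceT => x; exact: continuous_poisson_weight.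
- rewrite -[X in _ --> X](mulr0 (- r^-1)); apply: cvgM; first exact: cvg_cst.
  exact: cvg_poisson_cdf.
- by move=> x _; case: (dG x).
- apply: cvg_at_right_filter; apply: differentiable_continuous.
  by apply/derivable1_diffP; case: (dG 0).
- by move=> x _; rewrite derive1E; case: (dG x).
Qed.

End GammaIntegral.

(** * Bounds on spanning probabilities *)

(** This is the union bound for independent events of probability [1 - a i]; the induction also
    carries that the product lies in [0, 1]. *)
Lemma weierstrass_prod (R : numDomainType) (I : Type) (r : seq I) (P : pred I)
    (a : I -> R) : (forall i, P i -> 0 <= a i <= 1) ->
  1 - \prod_(i <- r | P i) a i <= \sum_(i <- r | P i) (1 - a i).
Proof.
move=> a01; suff : 0 <= \prod_(i <- r | P i) a i <= 1 /\
   1 - \prod_(i <- r | P i) a i <= \sum_(i <- r | P i) (1 - a i) by case.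
elim: r => [|i r [/andP[IH0 IH1] IH]];
  first by rewrite !big_nil ler01 lexx subrr.
rewrite !big_cons; case: ifPn => Pi; last by rewrite IH0 IH1.
have /andP[a0 a1] := a01 _ Pi; split.
  by rewrite mulr_ge0 //= mulr_ile1.
set p := \prod_(j <- r | P j) a j in IH0 IH1 IH *.
rewrite (_ : 1 - a i * p = (1 - a i) + a i * (1 - p)); last by ring.
by rewrite lerD2l (le_trans _ IH) // ler_piMl // subr_ge0.
Qed.

Lemma cvg_series_exp_coeff (R : realType) (x : R) :
  series (exp_coeff x) @ \oo --> expR x.
Proof. exact: is_cvg_series_exp_coeff. Qed.

Lemma cvg_series_trunc (R : realType) (u : nat -> R) d :
  series (fun k => if (k < d)%N then u k else 0) @ \oo --> series u d.
Proof.
rewrite -(cvg_shiftn d); apply: cvg_near_cst; near=> N.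
rewrite /series /= (@big_cat_nat _ _ _ d) ?leq_addl //=.
rewrite [X in _ + X](_ : _ = 0) ?addr0; last first.
  by rewrite big_nat big1 // => k /andP[dk _]; rewrite ltnNge dk.
by rewrite big_nat [RHS]big_nat; apply: eq_bigr => k /andP[_ ->].
Unshelve. all: by end_near. Qed.

(** The difference series has nonnegative terms, so its limit is at least the partial sum that
    includes the positive term [d]. *)
Lemma lt_lim_series (R : realType) (u v : nat -> R) (lu lv : R) d :
  series u @ \oo --> lu -> series v @ \oo --> lv ->
  (forall k, u k <= v k) -> u d < v d -> lu < lv.
Proof.
move=> ulu vlv uv uvd; rewrite -subr_gt0.
have duv : series (fun k => v k - u k) @ \oo --> lv - lu.
  rewrite (_ : series _ = fun N => series v N - series u N); first exact: cvgB.
  by apply/funext => N; rewrite /series /= sumrB.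
apply: (@lt_le_trans _ _ (series (fun k => v k - u k) d.+1)).
  rewrite /series /= big_nat_recr //= ltr_wpDl ?subr_gt0 //.
  by apply: sumr_ge0 => k _; rewrite subr_ge0.
rewrite -(cvg_lim _ duv) //; apply: nondecreasing_cvgn_le;
  last by apply/cvg_ex; exists (lv - lu).
by apply: nondecreasing_series => k _ _; rewrite subr_ge0.
Qed.

Definition egf {R : realType} (u : nat -> R) (y : R) : R :=
  limn (series (fun k => u k * exp_coeff y k)).

Lemma cvg_egf (R : realType) (u : nat -> R) (y : R) :
  0 <= y -> (forall k, 0 <= u k <= 1) ->
  series (fun k => u k * exp_coeff y k) @ \oo --> egf u y.
Proof.
move=> y0 u01; apply: (@series_le_cvg _ _ (exp_coeff y)).
- by move=> k; case/andP: (u01 k) => ? _; rewrite mulr_ge0 // exp_coeff_ge0.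
- by move=> k; exact: exp_coeff_ge0.
- by move=> k; case/andP: (u01 k) => ? ?; rewrite ler_piMl // exp_coeff_ge0.
exact: is_cvg_series_exp_coeff.
Qed.

Lemma egf_ge0 (R : realType) (u : nat -> R) (y : R) :
  0 <= y -> (forall k, 0 <= u k) -> 0 <= egf u y.
Proof.
move=> y0 u0; have S0 N : 0 <= series (fun k => u k * exp_coeff y k) N.
  by apply: sumr_ge0 => k _; rewrite mulr_ge0 // exp_coeff_ge0.
rewrite /egf; have [cu|ncu] := pselect (cvgn (series (fun k => u k * exp_coeff y k))).
  by apply: limr_ge => //; near=> N.
(* A divergent sequence has the default limit 0. *)
by rewrite dvgP.
Unshelve. all: by end_near. Qed.

Section SpanProb.
Context {R : realType} (q : R) (q1 : 1 < q).

Let q0 : 0 < q. Proof. exact: lt_trans q1. Qed.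

Lemma span_prob_lt k c : (k < c)%N -> span_prob q k c = 0.
Proof.
by move=> kc; rewrite /span_prob (bigD1 (Ordinal kc)) //= divff ?subrr ?mul0r // expf_neq0 // gt_eqF.
Qed.

Lemma span_prob_factor k c (j : 'I_c) : (c <= k)%N ->
  0 < 1 - q ^+ j / q ^+ k < 1.
Proof.
move=> ck; rewrite subr_gt0 gtrBl divr_gt0 ?exprn_gt0 // andbT.
by rewrite ltr_pdivrMr ?exprn_gt0 // mul1r ltr_eXn2l // (leq_trans (ltn_ord j)).
Qed.

Lemma span_prob_gt0 k c : (c <= k)%N -> 0 < span_prob q k c.
Proof. by move=> ck; apply: prodr_gt0 => j _;
  case/andP: (span_prob_factor k c j ck). Qed.

Lemma span_prob01 k c : 0 <= span_prob q k c <= 1.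
Proof.
have [kc|ck] := ltnP k c; first by rewrite span_prob_lt // lexx ler01.
rewrite (ltW (span_prob_gt0 _ _ ck)) /=; apply: prodr_ile1 => j _.
by case/andP: (span_prob_factor k c j ck) => /ltW-> /ltW->.
Qed.

(** Union bound over the factors: 1 minus factor [j] is q^(j - k), written as q^-(d - j) * q^d / q^k
    to isolate the sum that [alpha] dominates. *)
Lemma span_prob_compl k d : (d <= k)%N ->
  1 - span_prob q k d <= (\sum_(j < d) q ^- (d - j)) * q ^+ d / q ^+ k.
Proof.
move=> dk; apply: le_trans (weierstrass_prod _ _ _ _ _ _) _.
  by move=> j _; case/andP: (span_prob_factor k d j dk) => /ltW-> /ltW->.
rewrite mulr_suml mulr_suml ler_sum // => j _; rewrite opprB addrC subrK.
have -> : q ^+ d = q ^+ (d - j) * q ^+ j by rewrite -exprD subnK // ltnW.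
rewrite mulrA mulVf ?mul1r //.
by rewrite expf_neq0 // gt_eqF.
Qed.

Lemma cvg_span_prob d : (fun k => span_prob q k d) @ \oo --> (1 : R).
Proof.
set s := \sum_(j < d) q ^- (d - j).
apply: (@squeeze_cvgr _ _ _ _ (fun k => 1 - s * q ^+ d * q^-1 ^+ k) (fun=> 1)).
- near=> k; have dk : (d <= k)%N by near: k; exists d.
  case/andP: (span_prob01 k d) => _ ->; rewrite andbT lerBlDl addrC -lerBlDl.
  by rewrite exprVn; exact: span_prob_compl.
- rewrite -[X in _ --> X](subr0 (1 : R)); apply: cvgB; first exact: cvg_cst.
  rewrite -[X in _ --> X](mulr0 (s * q ^+ d)); apply: cvgM;
    first exact: cvg_cst.
  by apply: cvg_expr; rewrite normfV gtr0_norm // invf_lt1.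
- exact: cvg_cst.
Unshelve. all: by end_near. Qed.

End SpanProb.

(** * Numerical bounds on alpha *)

Section Alpha.
Context {R : realType} (N d : nat) (N1 : (1 < N)%N).
Let q : R := N%:R.
Let q1 : 1 < q. Proof. by rewrite ltr1n. Qed.
Let q0 : 0 < q. Proof. exact: lt_trans q1. Qed.

Let neg_pow (j : 'I_d) : 0 < 1 - q ^- (d - j) < 1.
Proof.
rewrite subr_gt0 gtrBl invr_gt0 exprn_gt0 // andbT invf_lt1 ?exprn_gt0 //.
by rewrite exprn_egt1 // -lt0n subn_gt0.
Qed.

(** Termwise x < - ln (1 - x), which is 1 + y < e^y at y = -x; strictness of the sum needs at least
    one term. *)
Lemma lt_sum_alpha : (0 < d)%N -> \sum_(j < d) q ^- (d - j) < alpha N d.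
Proof.
move=> d0; rewrite /alpha -sumrN.
have lt1 (j : 'I_d) : q ^- (d - j) < - ln (1 - q ^- (d - j)).
  have /andP[p0 p1] := neg_pow j.
  rewrite ltrNr -[X in _ < X]expRK ltr_ln ?posrE ?expR_gt0 //=.
  by rewrite -[X in X < _]/(1 + - _) expR_gt1Dx // oppr_eq0 invr_eq0 expf_neq0 // gt_eqF.
apply: ltr_sum => [|j _]; last exact: lt1.
by apply/hasP; exists (Ordinal d0) => //; rewrite mem_index_enum.
Qed.

(** As q^-(d - k) = q^k / q^d, the sum of logarithms is that of a spanning probability. An upper
    bound on [alpha] thus becomes a lower bound on the chance that [d] vectors suffice. *)
Lemma alphaE : alpha N d = - ln (span_prob q d d).
Proof.
rewrite /alpha; congr (- _); rewrite /span_prob.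
transitivity (ln (\prod_(k < d) (1 - q ^- (d - k)))).
  rewrite -[LHS]expRK; congr ln; rewrite (big_morph expR (@expRD R) (@expR0 R)).
  apply: eq_bigr => j _; rewrite lnK // posrE /=.
  by case/andP: (neg_pow j).
congr ln; apply: eq_bigr => j _; congr (1 - _).
have -> : q ^+ d = q ^+ (d - j) * q ^+ j by rewrite -exprD subnK // ltnW.
rewrite invfM mulrCA divff ?mulr1 //.
by rewrite expf_neq0 // gt_eqF.
Qed.

(* The worst case is q = 2, where the product decreases to 0.2887... *)
Lemma span_prob_ge : 288 / 1000 <= span_prob q d d.
Proof.
pose L m : R := \prod_(i < m) (1 - 2 ^- i.+1).
have fac i : 0 <= (1 - 2 ^- i.+1 : R) <= 1.
  rewrite subr_ge0 gerBl invr_ge0 exprn_ge0 // andbT.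
  by rewrite invf_le1 ?exprn_gt0 // exprn_ege1 // ler1n.
(* [315 / 1024] is [L 4], and the bracket is 1 at [m = 0]. The extra power e = 2^-(m+4) lets the
   induction close: the step amounts to e <= 1/16. Without it, 315/1024 * 15/16 still exceeds
   0.288. *)
have L4 m : 315 / 1024 * (15 / 16 + 2 ^- (m + 4)) <= L (m + 4)%N.
  elim: m => [|m IH].
    rewrite add0n /L !big_ord_recl big_ord0 /=. lra.
  rewrite addSn /L big_ord_recr /= -/(L (m + 4)%N).
  have /andP[f0 f1] := fac (m + 4)%N.
  apply: le_trans (ler_wpM2r f0 IH).
  rewrite exprS invfM.
  have e0 : 0 <= (2 ^- (m + 4) : R) by rewrite invr_ge0 exprn_ge0.
  have e1 : (2 ^- (m + 4) : R) <= 1 / 16.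
    rewrite div1r lef_pV2 ?posrE ?exprn_gt0 //= exprD.
    rewrite [leLHS](_ : _ = 1 * 2 ^+ 4) ?ler_pM2r ?exprn_ege1 ?ler1n ?exprn_gt0 //.
    by rewrite mul1r; ring.
  move: (2 ^- (m + 4)) e0 e1 => e e0 e1.
  nra.
(* [L] is nonincreasing, so the bound from index 4 on also covers small [d]. *)
have Ld : L (d + 4)%N <= L d.
  rewrite /L big_split_ord /= ler_piMr //; first by apply: prodr_ge0 => i _;
    case/andP: (fac i).
  by apply: prodr_ile1 => i _; apply: fac.
(* Reversing the index turns q^j / q^d into q^-(i+1), which is at most 2^-(i+1). *)
have dL : L d <= span_prob q d d.
  rewrite /L /span_prob [leRHS](reindex_inj rev_ord_inj) /=.
  apply: ler_prod => i _; case/andP: (fac i) => -> _ /=.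
  rewrite lerD2l lerN2.
  have -> : q ^+ (d - i.+1) / q ^+ d = q ^- i.+1.
    have -> : q ^+ d = q ^+ (d - i.+1) * q ^+ i.+1 by rewrite -exprD subnK.
    rewrite invfM mulrA divff ?mul1r //.
    by rewrite expf_neq0 // gt_eqF.
  rewrite lef_pV2 ?posrE ?exprn_gt0 //; apply: lerXn2r.
  - by rewrite nnegrE.
  - by rewrite nnegrE ltW.
  - by rewrite /q ler_nat.
apply: le_trans dL; apply: le_trans Ld; apply: le_trans (L4 d).
have e0 : 0 <= (2 ^- (d + 4) : R) by rewrite invr_ge0 exprn_ge0.
lra.
Qed.

Lemma alpha_le : alpha N d <= 5 / 4 :> R.
Proof.
rewrite alphaE lerNl -[X in X <= _]expRK ler_ln ?posrE ?expR_gt0 ?span_prob_gt0 //=.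
apply: le_trans span_prob_ge.
(* Six terms of the exponential series give 3.4839..., and 1/3.48 is below the 0.288 of
   [span_prob_ge]. *)
have h : 348 / 100 <= expR (5 / 4) :> R.
  have x0 : 0 <= 5 / 4 :> R by lra.
  have : Spart 6 (5 / 4) <= expR (5 / 4) :> R.
    rewrite SpartE; apply: nondecreasing_cvgn_le;
      last exact: is_cvg_series_exp_coeff.
    by apply: nondecreasing_series => k _ _; exact: exp_coeff_ge0.
  apply: le_trans; rewrite /Spart;
    have [x xE] : exists x : R, x = 5 / 4 by exists (5 / 4).
  rewrite -xE.
  rewrite !big_ord_recr big_ord0 /= !factS fact0 muln1 !natrM xE.
  lra.
rewrite expRN; apply: le_trans (_ : (348 / 100)^-1 <= _); last lra.
have p0 : 0 < 348 / 100 :> R by lra.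
by rewrite lef_pV2 ?posrE ?p0 ?expR_gt0 ?h.
Qed.

End Alpha.

(** * A single generation *)

Section OneGenerationSeries.
Context {R : realType} (F : finFieldType) (d : nat).
Let q : R := #|F|%:R.
Let q1 : 1 < q. Proof. by rewrite ltr1n; exact: card_finNzRing_gt1. Qed.
Let D k := span_prob q k d.

Let D01 k : 0 <= D k <= 1. Proof. exact: span_prob01. Qed.

Let cvg_Dexp y : (fun N => D N * series (exp_coeff y) N) @ \oo --> expR y.
Proof.
rewrite -[X in _ --> X]mul1r; apply: cvgM; first exact: cvg_span_prob.
exact: cvg_series_exp_coeff.
Qed.

(** Summation by parts: the terms up to [N] add up to D N * S_N(y) minus the partial sum of D k *
    y^k / k!, and D N tends to 1. *)
Lemma E_M_Spart y : 0 <= y ->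
  E_M F d (fun m => Spart m y) = expR y - egf (fun k => span_prob q k d) y.
Proof.
move=> y0; apply: cvg_lim => //; rewrite -cvg_shiftS /=.
rewrite (_ : (fun _ => _) = fun N => D N * series (exp_coeff y) N -
  series (fun k => D k * exp_coeff y k) N).
  by apply: cvgB; [exact: cvg_Dexp|exact: cvg_egf].
apply/funext; elim=> [|N IH].
  by rewrite /series /= big_nat1 !big_geq // pM0 mul0r mulr0 subrr.
rewrite seriesSr /= {}IH pMS SpartE !seriesSr /= -/(D N) -/(D N.+1).
by ring.
Qed.

(** The same summation by parts with [D] shifted by one: the generation is given one extra packet. A
    second index shift is needed because the terms [m = 0] and [m = 1] both vanish. *)
Lemma E_M_Spart_pred y : 0 <= y ->
  E_M F d (fun m => Spart m.-1 y) = expR y - egf (fun k => span_prob q k.+1 d) y.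
Proof.
move=> y0; apply: cvg_lim => //; rewrite -cvg_shiftS -cvg_shiftS /=.
rewrite (_ : (fun _ => _) = fun N => D N.+1 * series (exp_coeff y) N -
  series (fun k => D k.+1 * exp_coeff y k) N).
  apply: cvgB; last by apply: cvg_egf.
  rewrite -[X in _ --> X]mul1r; apply: cvgM; last exact: cvg_series_exp_coeff.
  by rewrite (cvg_shiftS D); exact: cvg_span_prob.
apply/funext; elim=> [|N IH].
  rewrite /series /= !big_nat_recr //= !big_geq // pM0 mul0r mulr0 subrr add0r.
  by rewrite /Spart big_ord0 mulr0 addr0.
rewrite seriesSr /= {}IH pMS SpartE /= !seriesSr /= -/(D N.+1) -/(D N.+2).
by ring.
Qed.

Hypothesis d0 : (0 < d)%N.
Let a : R := alpha #|F| d.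

(** Closed form of the exponential generating function of the majorant [b] of [1 - D k], namely 1
    for k < d and a * q^(d - k) from [d] on. *)
Definition failure_bound y : R :=
  Spart d y + a * (#|F| ^ d)%:R * expR (y / q) - a * (#|F| ^ d)%:R * Spart d (y / q).

Lemma failure_bound0 : failure_bound 0 = 1.
Proof.
rewrite /failure_bound mul0r !SpartE -(prednK d0) series_exp_coeff0 expR0.
by rewrite addrK.
Qed.

Lemma continuous_failure_bound : continuous failure_bound.
Proof.
have cq : continuous (fun y : R => y / q).
  by move=> y; apply: cvgM; [exact: cvg_id|exact: cvg_cst].
move=> y; apply: cvgB; first apply: cvgD.
- exact: continuous_Spart.
- apply: cvgM; first exact: cvg_cst.
  by apply: (@continuous_comp _ _ _ (fun y : R => y / q) expR);
    [exact: cq|exact: continuous_expR].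
apply: cvgM; first exact: cvg_cst.
by apply: (@continuous_comp _ _ _ (fun y : R => y / q) (Spart d));
  [exact: cq|exact: continuous_Spart].
Qed.

Let b k : R := if (k < d)%N then 1 else a * (q ^+ d / q ^+ k).

Let cvg_bound y :
  series (fun k => b k * exp_coeff y k) @ \oo --> failure_bound y.
Proof.
set c := a * (#|F| ^ d)%:R.
(* The geometric tail is extended to all [k], where it sums to an exponential at y / q, and
   corrected on the finitely many k < d. *)
rewrite (_ : series _ = fun N =>
    series (fun k => if (k < d)%N then exp_coeff y k - c * exp_coeff (y / q) k else 0) N
    + c * series (exp_coeff (y / q)) N).
  rewrite (_ : failure_bound y =
      series (fun k => exp_coeff y k - c * exp_coeff (y / q) k) d + c * expR (y / q)).
    apply: cvgD; first exact: cvg_series_trunc.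
    by apply: cvgM; [exact: cvg_cst|exact: cvg_series_exp_coeff].
  rewrite /failure_bound -/c !SpartE /series /= sumrB -mulr_sumr; ring.
apply/funext => N; rewrite /series /= mulr_sumr -big_split /=.
apply: eq_bigr => k _; rewrite /b; case: ifP => _; first by rewrite subrK mul1r.
rewrite add0r /exp_coeff /= /c natrX -/q expr_div_n; ring.
Qed.

(** Multiplied by e^y, the two halves of the absolute value become termwise comparisons 1 - b k <= D
    k and b k - 1 <= D k, both strict at [k = d]. *)
Lemma norm_failure_bound_lt y : 0 < y ->
  `|1 - expR (- y) * failure_bound y| < expR (- y) * egf (fun k => span_prob q k d) y.
Proof.
move=> y0.
have e0 k : 0 < exp_coeff y k by rewrite divr_gt0 ?exprn_gt0 // ltr0n fact_gt0.
have qk k : 0 < q ^+ k by rewrite exprn_gt0 // (lt_trans _ q1).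
have alpha_lt : \sum_(j < d) q ^- (d - j) < a by apply: lt_sum_alpha => //;
  exact: card_finNzRing_gt1.
have a0 : 0 < a.
  apply: le_lt_trans alpha_lt; apply: sumr_ge0 => j _.
  by rewrite invr_ge0 ltW.
have ale : a <= 5 / 4 by apply: alpha_le; exact: card_finNzRing_gt1.
have Dge : 288 / 1000 <= D d by apply: span_prob_ge; exact: card_finNzRing_gt1.
have cD := cvg_egf R D y (ltW y0) D01.
have lt_upper : expR y - failure_bound y < egf D y.
  have ce : series (fun k => (1 - b k) * exp_coeff y k) @ \oo --> expR y - failure_bound y.
    rewrite (_ : series _ = fun N => series (exp_coeff y) N - series (fun k => b k * exp_coeff y k) N).
      by apply: cvgB; [exact: cvg_series_exp_coeff|exact: cvg_bound].
    by apply/funext => N; rewrite /series /= -sumrB; apply: eq_bigr => k _;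
      rewrite mulrBl mul1r.
  apply: (lt_lim_series _ _ _ _ _ d ce cD) => [k|].
    rewrite ler_pM2r // /b; case: ltnP => kd.
      by rewrite subrr; case/andP: (D01 k).
    rewrite lerBlDr -lerBlDl (le_trans (span_prob_compl q q1 k d kd)) //.
    by rewrite -mulrA ler_wpM2r ?(ltW alpha_lt) // divr_ge0 // ltW.
  rewrite ltr_pM2r // /b ltnn ltrBlDr -ltrBlDl.
  apply: le_lt_trans (span_prob_compl q q1 d d (leqnn d)) _.
  by rewrite -mulrA ltr_pM2r // divr_gt0.
(* For k < d, b k - 1 is 0. At [k = d] it is a - 1 <= 1/4 < 0.288 <= D d. Beyond [d] the ratio q^d /
   q^k is at most 1/2, so b k <= 5/8 and b k - 1 is negative. *)
have lt_lower : failure_bound y - expR y < egf D y.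
  have ce : series (fun k => (b k - 1) * exp_coeff y k) @ \oo --> failure_bound y - expR y.
    rewrite (_ : series _ = fun N => series (fun k => b k * exp_coeff y k) N - series (exp_coeff y) N).
      by apply: cvgB; [exact: cvg_bound|exact: cvg_series_exp_coeff].
    by apply/funext => N; rewrite /series /= -sumrB; apply: eq_bigr => k _;
      rewrite mulrBl mul1r.
  apply: (lt_lim_series _ _ _ _ _ d ce cD) => [k|].
    rewrite ler_pM2r // /b; case: ltnP => kd.
      by rewrite subrr; case/andP: (D01 k).
    case/andP: (D01 k) => Dk0 _; move: kd;
      rewrite leq_eqVlt => /orP[/eqP <-|dk].
      by rewrite divff ?gt_eqF //; lra.
    have : q ^+ d / q ^+ k <= 1 / 2.
      rewrite ler_pdivrMr // -(prednK (leq_ltn_trans (leq0n d) dk)) exprS mulrA.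
      have : q ^+ d <= q ^+ k.-1.
        by rewrite ler_weXn2l ?(ltW q1) // -ltnS (prednK (leq_ltn_trans (leq0n d) dk)).
      have : 2 <= q by rewrite /q ler_nat; exact: card_finNzRing_gt1.
      have := qk k.-1.
      move: (q ^+ d) (q ^+ k.-1) => u v; nra.
    move: (q ^+ d / q ^+ k) => u hu; nra.
  rewrite ltr_pM2r // /b ltnn divff ?gt_eqF //; lra.
rewrite [X in `|X|](_ : _ = expR (- y) * (expR y - failure_bound y));
  last first.
  by rewrite [RHS]mulrBr expRN mulVf // gt_eqF ?expR_gt0.
rewrite normrM gtr0_norm ?expR_gt0 // ltr_pM2l ?expR_gt0 //.
by rewrite ltr_norml ltrNl opprB lt_lower.
Qed.

End OneGenerationSeries.

(** * Tail sums and Poisson integrals *)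

Section NonnegSeries.
Context {R : realType}.

Lemma cvg_bigsum (I : finType) (u : I -> nat -> R) (l : I -> R) :
  (forall i, u i @ \oo --> l i) ->
  (fun N => \sum_i u i N) @ \oo --> \sum_i l i.
Proof.
by move=> ul; apply: cvg_big => [|i _]; [exact: add_continuous|exact: ul].
Qed.

Lemma nneseries_EFin (u : nat -> R) (l : R) :
  series u @ \oo --> l -> (\sum_(0 <= k <oo) (u k)%:E = l%:E)%E.
Proof.
move=> ul; rewrite (_ : (fun n => (\sum_(0 <= k < n) (u k)%:E)%E) = EFin \o series u).
  by rewrite EFin_lim; [rewrite (cvg_lim _ ul)|apply/cvg_ex; exists l].
by apply/funext => N; rewrite /= sumEFin.
Qed.

Lemma nneseries_cvg (u : nat -> R) : (forall k, 0 <= u k) ->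
  (\sum_(0 <= k <oo) (u k)%:E < +oo)%E -> cvgn (series u).
Proof.
move=> u0; set S := (\sum_(0 <= k <oo) _)%E => Soo.
have Sle N : ((series u N)%:E <= S)%E.
  by rewrite /series /= -sumEFin; apply: nneseries_lim_ge => k _ _;
    rewrite lee_fin.
have S0 : (0 <= S)%E by apply: nneseries_ge0 => k _ _; rewrite lee_fin.
apply: nondecreasing_is_cvgn; first by apply: nondecreasing_series => k _ _.
exists (fine S) => _ [N _ <-].
by rewrite -lee_fin fineK ?Sle // ge0_fin_numE.
Qed.

(* Summation by parts for the expectation of [H w = h 0 + ... + h (w - 1)]
   under the law with distribution function [c]. *)
Lemma tail_sum (h H c p : nat -> R) :
  (forall t, 0 <= h t) -> (forall w, H w = \sum_(t < w) h t) ->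
  p 0%N = 0 -> (forall w, p w.+1 = c w.+1 - c w) -> (forall w, 0 <= p w) ->
  c @ \oo --> (1 : R) ->
  (\sum_(0 <= w <oo) (H w * p w)%:E = \sum_(0 <= t <oo) (h t * (1 - c t))%:E)%E.
Proof.
move=> h0 HE p0 pS pge c1.
have cnd : nondecreasing_seq c.
  by apply/nondecreasing_seqP => w; rewrite -subr_ge0 -pS.
have cle t : c t <= 1.
  rewrite -(cvg_lim _ c1) //; apply: nondecreasing_cvgn_le => //.
  by apply/cvg_ex; exists 1.
have H0 w : 0 <= H w by rewrite HE sumr_ge0.
have u0 w : 0 <= H w * p w by rewrite mulr_ge0.
have v0 t : 0 <= h t * (1 - c t) by rewrite mulr_ge0 // subr_ge0.
(* Exact summation by parts up to [N], before [c N] is replaced by its limit 1. *)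
have part N : \sum_(0 <= w < N.+1) H w * p w = \sum_(t < N) h t * (c N - c t).
  elim: N => [|N IH].
    by rewrite big_nat1 p0 mulr0 big_ord0.
  rewrite big_nat_recr //= IH pS big_ord_recr /= HE big_ord_recr /=.
  rewrite mulrDl addrA; congr (_ + _); rewrite mulr_suml -big_split /=.
  by apply: eq_bigr => t _; rewrite -mulrDr; congr (_ * _); ring.
apply/eqP; rewrite eq_le; apply/andP; split.
  apply: lime_le; first by apply: is_cvg_nneseries => w _ _; rewrite lee_fin.
  near=> N; rewrite sumEFin.
  have N0 : (0 < N)%N by near: N; exists 1%N.
  rewrite -(prednK N0) part.
  apply: le_trans (_ : (\sum_(0 <= t < N.-1) (h t * (1 - c t))%:E <= _)%E).
    rewrite sumEFin lee_fin big_mkord; apply: ler_sum => t _.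
    by rewrite ler_wpM2l // lerB.
  by apply: nneseries_lim_ge => t _ _; rewrite lee_fin.
set S := (X in (_ <= X)%E).
have S0 : (0 <= S)%E by apply: nneseries_ge0 => k _ _; rewrite lee_fin.
have [->|Soo] := eqVneq S +oo%E; first exact: leey.
have SE : S = (fine S)%:E by rewrite fineK // ge0_fin_numE // ltey.
apply: lime_le; first by apply: is_cvg_nneseries => w _ _; rewrite lee_fin.
near=> M; rewrite sumEFin SE lee_fin big_mkord.
(* The first [M] tails are kept while [N] goes to infinity in [part]. *)
have lim : (fun N => \sum_(t < M) h t * (c N - c t)) @ \oo --> \sum_(t < M) h t * (1 - c t).
  apply: cvg_bigsum => t; apply: cvgM; first exact: cvg_cst.
  by apply: cvgB => //; exact: cvg_cst.
rewrite -(cvg_lim _ lim) //; apply: limr_le; first by apply/cvg_ex; eexists;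
  exact: lim.
near=> N; have MN : (M <= N)%N by near: N; exists M.
rewrite -lee_fin -SE.
apply: le_trans (_ : (\sum_(0 <= w < N.+1) (H w * p w)%:E <= _)%E); last first.
  by apply: nneseries_lim_ge => t _ _; rewrite lee_fin.
rewrite sumEFin lee_fin part.
rewrite -!(big_mkord predT (fun t => h t * (c N - c t))) /=.
rewrite [leRHS](@big_cat_nat _ _ _ M) //= lerDl.
rewrite big_nat; apply: sumr_ge0 => t /andP[_ tN].
by rewrite mulr_ge0 // subr_ge0 cnd // ltnW.
Unshelve. all: by end_near. Qed.

End NonnegSeries.

(** * Integrals of Poisson mixtures *)

Section PoissonIntegral.
Context {R : realType} (r : R) (v : nat -> R) (f : R -> R).
Hypotheses (r0 : 0 < r) (v0 : forall t, 0 <= v t).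
Hypothesis vf : forall x : R, 0 <= x ->
  series (fun t => v t * exp_coeff (r * x) t) @ \oo --> expR (r * x) * f x.

Let term t x := v t * (expR (- (r * x)) * exp_coeff (r * x) t).

Let cvg_term x : 0 <= x -> series (term ^~ x) @ \oo --> f x.
Proof.
move=> x0; rewrite (_ : series _ = fun N => expR (- (r * x)) *
    series (fun t => v t * exp_coeff (r * x) t) N).
  rewrite -[X in _ --> X](mulKf (lt0r_neq0 (expR_gt0 (r * x)))) -expRN.
  by apply: cvgM; [exact: cvg_cst|exact: vf].
by apply/funext => N; rewrite /series /= mulr_sumr; apply: eq_bigr => t _;
  rewrite mulrCA.
Qed.

Let measurable_term t : measurable_fun `[(0 : R), +oo[ (term t).
Proof.
apply: measurable_funM; first exact: measurable_cst.
apply: (measurable_funS measurableT) => //.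
by apply: continuous_measurable_fun; exact: continuous_poisson_weight.
Qed.

Let term_ge0 t x : 0 <= x -> 0 <= term t x.
Proof.
by move=> x0; rewrite mulr_ge0 // mulr_ge0 ?expR_ge0 // exp_coeff_ge0 // mulr_ge0 // ltW.
Qed.

Lemma poisson_mixture_ge0 x : 0 <= x -> 0 <= f x.
Proof.
move=> x0; have h := cvg_term _ x0; rewrite -(cvg_lim _ h) //.
apply: limr_ge; first by apply/cvg_ex; exists (f x).
by near=> N; apply: sumr_ge0 => t _; exact: term_ge0.
Unshelve. all: by end_near. Qed.

Lemma measurable_poisson_mixture : measurable_fun `[(0 : R), +oo[ f.
Proof.
apply: (@measurable_fun_cvg _ _ _ _ (fun N x => series (term ^~ x) N)).
  by move=> N; apply: measurable_sum => t; exact: measurable_term.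
by move=> x /=; rewrite in_itv /= andbT; exact: cvg_term.
Qed.

(** By [vf], [f x] is the mean of [v] at a Poisson count of parameter r * x. Nonnegativity allows
    integration term by term, and each weight integrates to 1/r. *)
Lemma integral_poisson_mixture :
  (\int[lebesgue_measure]_(x in `[0%R, +oo[) (f x)%:E =
   r^-1%:E * \sum_(0 <= t <oo) (v t)%:E)%E.
Proof.
transitivity (\int[lebesgue_measure]_(x in `[0%R, +oo[)
    (\sum_(0 <= t <oo) (term t x)%:E))%E.
  apply: eq_integral => x; rewrite inE /= in_itv /= andbT => x0.
  by rewrite (nneseries_EFin _ _ (cvg_term _ x0)).
rewrite integral_nneseries //; last 2 first.
- by move=> t; apply/measurable_EFinP; exact: measurable_term.
- by move=> t x /=; rewrite in_itv /= andbT lee_fin; exact: term_ge0.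
rewrite -nneseriesZl; last by move=> t _; rewrite lee_fin.
apply: eq_eseriesr => t _.
under eq_integral => x _ do rewrite /term EFinM.
rewrite ge0_integralZl_EFin //.
- by rewrite integral_poisson_weight // muleC.
- by move=> x /=; rewrite in_itv /= andbT lee_fin => x0;
    rewrite mulr_ge0 ?expR_ge0 // exp_coeff_ge0 // mulr_ge0 // ltW.
apply/measurable_EFinP; apply: (measurable_funS measurableT) => //.
by apply: continuous_measurable_fun; exact: continuous_poisson_weight.
Qed.

End PoissonIntegral.

(** Were the integral of h - f zero, h - f would vanish almost everywhere, yet it is positive on
    [](0 : R), 1[]. Finiteness for [f] allows the cancellation; that of [h] may be infinite. *)
Lemma lt_integral (R : realType) (f h : R -> R) :
  measurable_fun `[(0 : R), +oo[ f -> measurable_fun `[(0 : R), +oo[ h ->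
  (forall x : R, 0 <= x -> 0 <= f x) -> (forall x : R, 0 <= x -> f x <= h x) ->
  (forall x : R, 0 < x -> f x < h x) ->
  (\int[lebesgue_measure]_(x in `[0%R, +oo[) (f x)%:E < +oo)%E ->
  (\int[lebesgue_measure]_(x in `[0%R, +oo[) (f x)%:E <
   \int[lebesgue_measure]_(x in `[0%R, +oo[) (h x)%:E)%E.
Proof.
move=> mf mh f0 fh fh_lt foo.
have mhf : measurable_fun `[(0 : R), +oo[ (fun x => h x - f x) by exact: measurable_funB.
have fh0 x : `[(0 : R), +oo[%classic x -> (0 <= (h x - f x)%:E)%E.
  by rewrite /= in_itv /= andbT lee_fin subr_ge0; exact: fh.
rewrite [ltRHS](_ : _ = (\int[lebesgue_measure]_(x in `[0%R, +oo[) (f x)%:E +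
    \int[lebesgue_measure]_(x in `[0%R, +oo[) (h x - f x)%:E)%E); last first.
  rewrite -ge0_integralD //.
  - by apply: eq_integral => x _; rewrite -EFinD addrC subrK.
  - by move=> x /=; rewrite in_itv /= andbT lee_fin; exact: f0.
  - exact/measurable_EFinP.
  - exact/measurable_EFinP.
rewrite lteDl; last first.
  rewrite ge0_fin_numE //; apply: integral_ge0 => x.
  by rewrite /= in_itv /= andbT lee_fin; exact: f0.
rewrite lt0e integral_ge0 // andbT; apply/eqP => I0.
have : (\int[@lebesgue_measure R]_(x in `[0%R, +oo[) `|(h x - f x)%:E| = 0)%E.
  by rewrite -[RHS]I0; apply: eq_integral => x; rewrite inE => /fh0 ?;
    rewrite gee0_abs.
have mE : measurable_fun `[(0 : R), +oo[ (fun x => (h x - f x)%:E) by exact/measurable_EFinP.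
have mI : measurable (`[(0 : R), +oo[ : set R) by [].
move=> I0'; have [N [mN N0 sub]] := (proj1 (ae_eq_integral_abs lebesgue_measure mI mE)) I0'.
have sN : `](0 : R), 1[ `<=` N.
  move=> x /=; rewrite in_itv /= => /andP[x0 _]; apply: sub => /= hx.
  have /hx : `[(0 : R), +oo[%classic x by rewrite /= in_itv /= andbT ltW.
  by case=> e; move: (fh_lt x x0); rewrite -subr_gt0 e ltxx.
have : (lebesgue_measure `](0%R : R), 1%R[ <= lebesgue_measure N)%E.
  by apply: le_measure => //; rewrite inE.
by rewrite [X in (_ <= X)%E]N0 lebesgue_measure_itv /= lte01 oppr0 adde0 lee_fin ler10.
Qed.

(** * All generations *)

Section PoissonizedMix.
Context {R : realType} {n : nat} (rho : 'I_n -> R).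
Hypotheses (rho0 : forall i, 0 < rho i) (rho1 : \sum_(i < n) rho i = 1).

Lemma mix01 w (u : 'I_n -> nat -> R) : (forall i k, 0 <= u i k <= 1) ->
  0 <= mix rho w u <= 1.
Proof.
by move=> u01; rewrite -[X in _ <= _ <= X](mix1 _ _ rho w rho1);
  apply: ler_mix => // i; rewrite ltW.
Qed.

Lemma expR_prod (x : R) : \prod_(i < n) expR (rho i * x) = expR x.
Proof.
by rewrite -(big_morph expR (@expRD R) (@expR0 R)) -mulr_suml rho1 mul1r.
Qed.

(** As the [rho i] sum to 1, e^x splits into the factors e^(rho i * x), which normalize each
    generating function to a Poisson mean. *)
Lemma cvg_mix_egf (u : 'I_n -> nat -> R) (x : R) : 0 <= x ->
  (forall i k, 0 <= u i k <= 1) ->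
  series (fun w => mix rho w u * exp_coeff x w) @ \oo -->
    expR x * \prod_(i < n) (expR (- (rho i * x)) * egf (u i) (rho i * x)).
Proof.
move=> x0 u01; rewrite big_split /= -[in expR x](expR_prod x) mulrA.
rewrite -big_split /= big1 ?mul1r => [|i _]; last first.
  by rewrite expRN mulfV // gt_eqF ?expR_gt0.
apply: cvg_mix => // [i|i k|i]; first exact: ltW.
  by case/andP: (u01 i k).
by apply: cvg_egf => //; rewrite mulr_ge0 // ltW.
Qed.

End PoissonizedMix.

(** The sum is the mean number of vectors needed to span, and its terms decay geometrically. *)
Lemma nneseries_span_prob_lty (R : realType) (q : R) (d : nat) : 1 < q ->
  (\sum_(0 <= k <oo) (1 - span_prob q k d)%:E < +oo)%E.
Proof.
move=> q1; set s := \sum_(j < d) q ^- (d - j).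
have q0 : 0 < q by exact: lt_trans q1.
have s0 : 0 <= s by apply: sumr_ge0 => j _; rewrite invr_ge0 exprn_ge0 // ltW.
have qV1 : `|q^-1| < 1 by rewrite normfV gtr0_norm // invf_lt1.
(* In the constant 1 + s, the 1 covers k < d, where q^d / q^k >= 1, and [s] covers k >= d. *)
have /cvg_ex[l hl] := @is_cvg_geometric_series R ((1 + s) * q ^+ d) q^-1 qV1.
apply: le_lt_trans (ltry l); rewrite -(nneseries_EFin _ _ hl).
apply: lee_nneseries => k; first by rewrite lee_fin subr_ge0;
  case/andP: (span_prob01 q q1 k d).
move=> _; rewrite lee_fin /= exprVn;
  have qk j : 0 < q ^+ j by rewrite exprn_gt0.
have [kd|dk] := ltnP k d.
  rewrite span_prob_lt // subr0 -mulrA -[leLHS]mul1r ler_pM // ?lerDl //.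
  by rewrite ler_pdivlMr // mul1r ler_weXn2l ?(ltW q1) ?(ltnW kd).
apply: le_trans (span_prob_compl q q1 k d dk) _; rewrite -/s -!mulrA.
by rewrite ler_wpM2r ?lerDr // divr_ge0 // ltW.
Qed.

Section CouponCollection.
Context {R : realType} (F : finFieldType) (n : nat) (g : 'I_n -> nat).
Variable rho : 'I_n -> R.
Hypotheses (n0 : (0 < n)%N) (g0 : forall i, (0 < g i)%N).
Hypotheses (rho0 : forall i, 0 < rho i) (rho1 : \sum_(i < n) rho i = 1).

Let q : R := #|F|%:R.
Let q1 : 1 < q. Proof. by rewrite ltr1n; exact: card_finNzRing_gt1. Qed.
Let D i k := span_prob q k (g i).
Let D01 i k : 0 <= D i k <= 1. Proof. exact: span_prob01. Qed.
Let c t := mix rho t D.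
Let c01 t : 0 <= c t <= 1. Proof. exact: mix01. Qed.

Let ES i x := E_M F (g i) (fun m => Spart m (rho i * x)).
Let ES1 i x := E_M F (g i) (fun m => Spart m.-1 (rho i * x)).
(** Probability that generation [i] is decodable at Poisson time [x]; [P1] is the same with one
    extra packet of that generation. *)
Let P i x := expR (- (rho i * x)) * egf (D i) (rho i * x).
Let P1 i x := expR (- (rho i * x)) * egf (fun k => D i k.+1) (rho i * x).

Let rhox i x : 0 <= x -> 0 <= rho i * x.
Proof. by move=> x0; rewrite mulr_ge0 // ltW. Qed.

Let ES_P i x : 0 <= x -> 1 - expR (- (rho i * x)) * ES i x = P i x.
Proof.
move=> x0; rewrite /ES E_M_Spart ?rhox // mulrBr {1}expRN mulVf;
  first by rewrite opprB addrC subrK.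
by rewrite gt_eqF ?expR_gt0.
Qed.

Let ES1_P1 i x : 0 <= x -> 1 - ES1 i x * expR (- (rho i * x)) = P1 i x.
Proof.
move=> x0; rewrite /ES1 E_M_Spart_pred ?rhox // mulrC mulrBr {1}expRN mulVf.
  by rewrite opprB addrC subrK.
by rewrite gt_eqF ?expR_gt0.
Qed.

(** By [norm_failure_bound_lt] this number exceeds an absolute value; positivity makes the quotients
    [P1 i x / P i x] meaningful. *)
Let P_gt0 i x : 0 < x -> 0 < P i x.
Proof.
move=> x0; have y0 : 0 < rho i * x by rewrite mulr_gt0.
exact: le_lt_trans (normr_ge0 _) (norm_failure_bound_lt F (g i) (g0 i) _ y0).
Qed.

Let P_ge0 i x : 0 <= x -> 0 <= P i x.
Proof.
move=> x0; rewrite mulr_ge0 ?expR_ge0 // egf_ge0 ?rhox // => k.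
by case/andP: (D01 i k).
Qed.

Let f x := 1 - \prod_(i < n) P i x.

Let series_f x : 0 <= x ->
  series (fun t => (1 - c t) * exp_coeff (1 * x) t) @ \oo --> expR (1 * x) * f x.
Proof.
rewrite mul1r => x0.
rewrite (_ : series _ = fun N => series (exp_coeff x) N -
    series (fun t => c t * exp_coeff x t) N); last first.
  by apply/funext => N; rewrite /series /= -sumrB; apply: eq_bigr => t _;
    rewrite mulrBl mul1r.
rewrite /f mulrBr mulr1; apply: cvgB; first exact: cvg_series_exp_coeff.
exact: cvg_mix_egf.
Qed.

Let c1_ge0 t : 0 <= 1 - c t.
Proof. by rewrite subr_ge0; case/andP: (c01 t). Qed.

Let integral_f :
  (\int[lebesgue_measure]_(x in `[0%R, +oo[) (f x)%:E =
   \sum_(0 <= t <oo) (1 - c t)%:E)%E.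
Proof.
rewrite (integral_poisson_mixture 1 _ _ ltr01 c1_ge0 series_f).
by rewrite invr1 mul1e.
Qed.

Let one_series i x : 0 <= x ->
  series (fun k => (1 - D i k) * exp_coeff (rho i * x) k) @ \oo -->
    expR (rho i * x) * (1 - P i x).
Proof.
move=> x0; rewrite (_ : series _ = fun N => series (exp_coeff (rho i * x)) N -
    series (fun k => D i k * exp_coeff (rho i * x) k) N); last first.
  by apply/funext => N; rewrite /series /= -sumrB; apply: eq_bigr => t _;
    rewrite mulrBl mul1r.
rewrite mulrBr mulr1 /P mulrA expRN mulfV ?gt_eqF ?expR_gt0 // mul1r.
apply: cvgB; first exact: cvg_series_exp_coeff.
by apply: cvg_egf => //; exact: rhox.
Qed.

(** By the union bound [f] is at most the sum of the 1 - P i x, whose integrals are the finite mean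
    spanning times divided by [rho i]. *)
Let integral_f_lty :
  (\int[lebesgue_measure]_(x in `[0%R, +oo[) (f x)%:E < +oo)%E.
Proof.
have D1 i k : 0 <= 1 - D i k by rewrite subr_ge0; case/andP: (D01 i k).
have P0 i x : 0 <= x -> 0 <= 1 - P i x.
  exact: (poisson_mixture_ge0 _ _ _ (rho0 i) (D1 i) (one_series i)).
have mP i : measurable_fun `[(0 : R), +oo[ (fun x => 1 - P i x).
  exact: (measurable_poisson_mixture _ _ _ (one_series i)).
have mf : measurable_fun `[(0 : R), +oo[ f.
  exact: (measurable_poisson_mixture _ _ _ series_f).
apply: (@le_lt_trans _ _ (\int[lebesgue_measure]_(x in `[0%R, +oo[)
    \sum_(i < n) (1 - P i x)%:E)%E).
  apply: ge0_le_integral => //.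
  - move=> x /=; rewrite in_itv /= andbT lee_fin => x0.
    exact: (poisson_mixture_ge0 _ _ _ ltr01 c1_ge0 series_f).
  - exact/measurable_EFinP.
  - by apply: emeasurable_sum => i; apply/measurable_EFinP; exact: mP.
  - move=> x /=; rewrite in_itv /= andbT => x0; rewrite sumEFin lee_fin /f.
    apply: weierstrass_prod => i _.
    by rewrite -subr_ge0 P0 // andbT P_ge0.
rewrite ge0_integral_sum //.
- apply: lte_sum_pinfty => i _.
  rewrite (integral_poisson_mixture (rho i) _ _ (rho0 i) (D1 i) (one_series i)).
  by apply: lte_mul_pinfty => //;
    [rewrite lee_fin invr_ge0 ltW|exact: nneseries_span_prob_lty].
- by move=> i; apply/measurable_EFinP; exact: mP.
- by move=> i x /=; rewrite in_itv /= andbT lee_fin; exact: P0.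
Qed.

(** Finiteness of the integral makes the tails 1 - c t summable, hence null: all generations are
    eventually decoded almost surely. *)
Let cvg_c : c @ \oo --> (1 : R).
Proof.
have h : (fun t => 1 - c t) @ \oo --> (0 : R).
  apply: cvg_series_cvg_0; apply: nneseries_cvg => //.
  by rewrite -integral_f integral_f_lty.
rewrite (_ : c = fun t => 1 - (1 - c t)); last by apply/funext => t;
  rewrite opprB addrC subrK.
by rewrite -[X in _ --> X](subr0 (1 : R)); apply: cvgB => //; exact: cvg_cst.
Qed.

Let pW_ge0 w : 0 <= pW F n g rho w :> R.
Proof.
by apply: sumr_ge0 => s _; apply: prodr_ge0 => k _; rewrite divr_ge0 // ltW.
Qed.

Let EW_tail : EW F n g rho = (\sum_(0 <= t <oo) (1 - c t)%:E)%E.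
Proof.
rewrite /EW (tail_sum (fun=> 1) (fun w => w%:R) c) //.
- by apply: eq_eseriesr => t _; rewrite mul1r.
- by move=> w; rewrite sumr_const card_ord.
- exact: pW0.
- by move=> w; rewrite pWS.
Qed.

(** Summation by parts with w^2 written as the sum of 2t + 1 over t < w. *)
Let EW2_tail : EW2 F n g rho =
  (2%:E * \sum_(0 <= t <oo) (t%:R * (1 - c t))%:E + \sum_(0 <= t <oo) (1 - c t)%:E)%E.
Proof.
rewrite /EW2 (tail_sum (fun t => 2 * t%:R + 1) (fun w => (w ^ 2)%:R) c) //.
- rewrite -nneseriesZl; last by move=> t _; rewrite lee_fin mulr_ge0.
  rewrite -nneseriesD; last 2 first.
  + by move=> t _ _; rewrite -EFinM lee_fin !mulr_ge0.
  + by move=> t _ _; rewrite lee_fin.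
  by apply: eq_eseriesr => t _; rewrite -EFinM -EFinD mulrDl mul1r mulrA.
- elim=> [|w IH]; first by rewrite big_ord0.
  by rewrite big_ord_recr /= -IH !natrX -addn1 natrD; ring.
- exact: pW0.
- by move=> w; rewrite pWS.
Qed.

Let f2 x := x * (1 - \sum_(i < n) rho i * (P1 i x / P i x) * \prod_(j < n) P j x).

(** Since t * x^t / t! = x * x^(t-1) / (t-1)!, the series is [x] times that of 1 - c t.+1. One step
    of [mix] in [c t.+1] charges the extra packet to some [j] and so replaces [P j] by [P1 j]. *)
Let series_f2 x : 0 <= x ->
  series (fun t => t%:R * (1 - c t) * exp_coeff (1 * x) t) @ \oo -->
    expR (1 * x) * f2 x.
Proof.
(* At [x = 0] the [P i] vanish, but the prefactor [x] makes both sides 0. *)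
rewrite mul1r le_eqVlt => /orP[/eqP <-|x0].
  rewrite /f2 mul0r mulr0; apply: cvg_near_cst; near=> N.
  rewrite /series /=; apply: big1 => -[|t] _; rewrite ?mul0r //.
  by rewrite /exp_coeff /= exprS !mul0r mulr0.
pose sh j i k := D i (k + (i == j))%N.
have cS : series (fun t => c t.+1 * exp_coeff x t) @ \oo -->
   \sum_(j < n) rho j * (expR x * \prod_(i < n) (expR (- (rho i * x)) * egf (sh j i) (rho i * x))).
  rewrite (_ : series _ = fun N => \sum_(j < n) rho j *
      series (fun t => mix rho t (sh j) * exp_coeff x t) N); last first.
    apply/funext => N; rewrite /series /=.
    under [RHS]eq_bigr => j _ do rewrite mulr_sumr.
    rewrite exchange_big /=; apply: eq_bigr => t _; rewrite /c /= mulr_suml.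
    by apply: eq_bigr => j _; rewrite -mulrA.
  apply: cvg_bigsum => j; apply: cvgM; first exact: cvg_cst.
  by apply: cvg_mix_egf => //; [exact: ltW|move=> i k; exact: D01].
(* The quotient cancels factor [j] of the product, leaving [P1 j] next to the [P i] with i != j. *)
have -> : expR x * f2 x = x * (expR x - \sum_(j < n) rho j * (expR x *
    \prod_(i < n) (expR (- (rho i * x)) * egf (sh j i) (rho i * x)))).
  rewrite /f2 mulrCA mulrBr mulr1 mulr_sumr; congr (_ * (_ - _)).
  apply: eq_bigr => j _; rewrite -!mulrA mulrCA; congr (_ * (_ * _)).
  rewrite (bigD1 j) //= [RHS](bigD1 j) //= mulKf ?gt_eqF ?P_gt0 //.
  rewrite [LHS]mulrA; congr (_ * _).
    by congr (_ * egf _ _); apply/funext => k; rewrite /sh eqxx addn1.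
  apply: eq_bigr => i /negbTE ij; rewrite /P; congr (_ * egf _ _).
  by apply/funext => k; rewrite /sh ij addn0.
rewrite -cvg_shiftS /=.
rewrite (_ : (fun _ => _) = fun N => x * (series (exp_coeff x) N -
    series (fun t => c t.+1 * exp_coeff x t) N)).
  by apply: cvgM; [exact: cvg_cst|apply: cvgB => //;
    exact: cvg_series_exp_coeff].
apply/funext => N; rewrite /series /= big_nat_recl // mul0r mul0r add0r.
rewrite -sumrB mulr_sumr; apply: eq_bigr => t _.
rewrite /exp_coeff /= exprS factS natrM.
have t0 : t`!%:R != 0 :> R by [].
have t1 : t.+1%:R != 0 :> R by [].
move: (c t.+1) (x ^+ t) (t`!%:R : R) (t.+1%:R : R) t0 t1 => a b h m h0 m0.
by field; rewrite h0 m0.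
Unshelve. all: by end_near. Qed.

Let integral_f2 :
  (\int[lebesgue_measure]_(x in `[0%R, +oo[) (f2 x)%:E =
   \sum_(0 <= t <oo) (t%:R * (1 - c t))%:E)%E.
Proof.
rewrite (integral_poisson_mixture 1 _ _ ltr01 _ series_f2).
  by rewrite invr1 mul1e.
by move=> t; rewrite mulr_ge0.
Qed.

Let integral_ES :
  (\int[lebesgue_measure]_(x in `[0%R, +oo[)
     (1 - \prod_(i < n) (1 - expR (- (rho i * x)) * ES i x))%:E =
   \int[lebesgue_measure]_(x in `[0%R, +oo[) (f x)%:E)%E.
Proof.
apply: eq_integral => x; rewrite inE /= in_itv /= andbT => x0.
by congr ((1 - _)%:E); apply: eq_bigr => i _; exact: ES_P.
Qed.

Lemma EW_integral : EW F n g rho =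
  (\int[lebesgue_measure]_(x in `[0%R, +oo[)
     (1 - \prod_(i < n) (1 - expR (- (rho i * x)) * ES i x))%:E)%E.
Proof. by rewrite integral_ES integral_f EW_tail. Qed.

Lemma EW2_integral : EW2 F n g rho =
  (2%:E * \int[lebesgue_measure]_(x in `[0%R, +oo[)
     (x * (1 - \sum_(i < n) rho i *
             ((1 - ES1 i x * expR (- (rho i * x))) /
              (1 - ES i x * expR (- (rho i * x)))) *
             \prod_(j < n) (1 - ES j x * expR (- (rho j * x)))))%:E
   + \int[lebesgue_measure]_(x in `[0%R, +oo[)
     (1 - \prod_(i < n) (1 - expR (- (rho i * x)) * ES i x))%:E)%E.
Proof.
rewrite integral_ES integral_f EW2_tail; congr (_ * _ + _)%E.
rewrite -integral_f2; apply: eq_integral => x;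
  rewrite inE /= in_itv /= andbT => x0.
have ESP i : 1 - ES i x * expR (- (rho i * x)) = P i x by rewrite mulrC ES_P.
congr ((_ * (1 - _))%:E); apply: eq_bigr => i _.
rewrite ES1_P1 // ESP; congr (_ * _).
by apply: eq_bigr => j _; rewrite ESP.
Qed.

Lemma EW_lt_bound : (EW F n g rho <
  \int[lebesgue_measure]_(x in `[0%R, +oo[)
    (1 - \prod_(i < n) (1 - expR (- (rho i * x)) *
       failure_bound F (g i) (rho i * x)))%:E)%E.
Proof.
rewrite EW_integral integral_ES.
set B := fun i x => 1 - expR (- (rho i * x)) * failure_bound F (g i) (rho i * x).
have BP x : 0 < x -> \prod_(i < n) B i x < \prod_(i < n) P i x.
  move=> x0; apply: le_lt_trans (ler_norm _) _; rewrite normr_prod.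
  apply: ltr_prod => [|i _].
    by apply/hasP; exists (Ordinal n0) => //; rewrite mem_index_enum.
  by rewrite normr_ge0 /=; apply: norm_failure_bound_lt => //; rewrite mulr_gt0.
apply: lt_integral => //.
- exact: (measurable_poisson_mixture _ _ _ series_f).
- apply: measurable_funB; first exact: measurable_cst.
  apply: (measurable_funS measurableT) => //.
  apply: measurable_prod => i _; apply: continuous_measurable_fun => x.
  apply: cvgB; first exact: cvg_cst.
  apply: (@continuous_comp _ _ _ (fun x => rho i * x)
    (fun y => expR (- y) * failure_bound F (g i) y)).
    by apply: cvgM; [exact: cvg_cst|exact: cvg_id].
  apply: cvgM; last exact: continuous_failure_bound.
  apply: (@continuous_comp _ _ _ -%R expR); last exact: continuous_expR.
  by apply: cvgN; exact: cvg_id.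
- exact: (poisson_mixture_ge0 _ _ _ ltr01 c1_ge0 series_f).
(* At [x = 0] a bounding factor is 1 - 1 = 0, so the bounding product vanishes and only the weak
   inequality is claimed. *)
- move=> x; rewrite le_eqVlt => /orP[/eqP <-|x0];
    last by rewrite lerD2l lerN2 ltW // BP.
  rewrite lerD2l lerN2 (bigD1 (Ordinal n0)) //= mulr0 failure_bound0 //.
  by rewrite oppr0 expR0 mulr1 subrr mul0r prodr_ge0 // => i _; exact: P_ge0.
- by move=> x x0; rewrite ltrD2l ltrN2 BP.
Qed.

End CouponCollection.

Theorem theorem5 (R : realType) (F : finFieldType) (n : nat) (g : 'I_n -> nat)
  (rho : 'I_n -> R) :
  (0 < n)%N ->
  (forall i, (0 < g i)%N) ->
  (forall i, 0 < rho i) ->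
  \sum_(i < n) rho i = 1 ->
  let q := #|F| in
  let ES (i : 'I_n) (x : R) := E_M F (g i) (fun m => Spart m (rho i * x)) in
  let ES1 (i : 'I_n) (x : R) := E_M F (g i) (fun m => Spart m.-1 (rho i * x)) in
  [/\ EW F n g rho =
        (\int[lebesgue_measure]_(x in `[0%R, +oo[)
           (1 - \prod_(i < n) (1 - expR (- (rho i * x)) * ES i x))%:E)%E,
      (EW F n g rho <
        \int[lebesgue_measure]_(x in `[0%R, +oo[)
           (1 - \prod_(i < n) (1 - expR (- (rho i * x)) *
              (Spart (g i) (rho i * x)
               + alpha q (g i) * (q ^ g i)%:R * expR (rho i * x / q%:R)
               - alpha q (g i) * (q ^ g i)%:R * Spart (g i) (rho i * x / q%:R))))%:E)%E
    & EW2 F n g rho =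
        (2%:E * \int[lebesgue_measure]_(x in `[0%R, +oo[)
           (x * (1 - \sum_(i < n) rho i *
                   ((1 - ES1 i x * expR (- (rho i * x))) /
                    (1 - ES i x * expR (- (rho i * x)))) *
                   \prod_(j < n) (1 - ES j x * expR (- (rho j * x)))))%:E
         + \int[lebesgue_measure]_(x in `[0%R, +oo[)
           (1 - \prod_(i < n) (1 - expR (- (rho i * x)) * ES i x))%:E)%E].
Proof.
move=> n0 g0 rho0 rho1 q ES ES1; split.
- exact: EW_integral.
- exact: EW_lt_bound.
- exact: EW2_integral.
Qed.
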